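(* Let $d\geq 2$ and let $\mathbf{F}_d$ be the free group on generators $x_1,\dots,x_d$, equipped with the generating system $S_{\mathbf{F}_d}=\{x_1^{\pm1},\dots,x_d^{\pm1}\}$. There exist p.m.p. ergodic actions $\mathbf{F}_d\curvearrowright^\alpha(X,\mu)$ and $\mathbf{F}_d\curvearrowright^\beta(Y,\nu)$ that are isometric orbit equivalent (with respect to $S_{\mathbf{F}_d}$ for both actions), such that $\alpha$ is not mixing but $\beta$ is mixing.
   Context: A p.m.p. action $\Gamma\curvearrowright^\alpha(X,\mu)$ of a countable group on a standard probability space is an action by bimeasurable bijections $\alpha(\gamma)$ of $X$ preserving the probability measure $\mu$. It is ergodic if every invariant measurable set has measure $0$ or $1$. It is mixing if for all measurable $A,B\subseteq X$, $\mu(\alpha(\gamma)A\cap B)\to\mu(A)\mu(B)$ as $\gamma\to\infty$ in $\Gamma$ (i.e. leaving every finite subset of $\Gamma$). Isometric orbit equivalence: given groups $\Gamma,\Lambda$ with fixed finite symmetric generating sets $S_\Gamma,S_\Lambda$, and a p.m.p. action $\alpha$ of $\Gamma$ on $(X,\mu)$, let $d_{\alpha(S_\Gamma)}(x,x')\in\mathbb{N}\cup\{+\infty\}$ be the graph distance on the graph with vertex set $X$ and edge set $\{(x,x')\in X\times X : \exists s\in S_\Gamma,\ \alpha(s)x=x'\}$ (equal to $+\infty$ if $x,x'$ lie in different connected components). Two p.m.p. actions $\Gamma\curvearrowright^\alpha(X,\mu)$ and $\Lambda\curvearrowright^\beta(Y,\nu)$ are isometric orbit equivalent if there exist a bimeasurable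 bijection $\Phi:X\to Y$ with $\Phi_*\mu=\nu$ and a $\Gamma$-invariant measurable set $X_0\subseteq X$ with $\mu(X_0)=1$ such that $\Phi(X_0)$ is $\Lambda$-invariant and $d_{\beta(S_\Lambda)}(\Phi(x),\Phi(x'))=d_{\alpha(S_\Gamma)}(x,x')$ for all $x,x'\in X_0$. *)

(* Defs.v *)
From HB Require Import structures.
From mathcomp Require Import all_boot all_order all_fingroup all_algebra.
From mathcomp Require Import all_classical all_reals all_analysis.

Set Implicit Arguments.
Unset Strict Implicit.
Unset Printing Implicit Defensive.

Import Order.TTheory GRing.Theory Num.Theory.

Local Open Scope classical_set_scope.

(* In [free_group d], elements are reduced words in the letters [x_i] (encoded as [(i, true)]) and
   [x_i^-1] (encoded as [(i, false)]); the product is concatenation followed by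
   free reduction. *)

Section FreeGroup.
Variable d : nat.
Implicit Types (a b : 'I_d * bool) (u v w : seq ('I_d * bool)).

Definition inv_letter a := (a.1, ~~ a.2).

Definition reduced w := sorted (fun a b => b != inv_letter a) w.

(* [push a w] is the reduced form of [a :: w] when [w] is reduced. *)
Definition push a w :=
  if w is b :: w' then if b == inv_letter a then w' else a :: w else [:: a].

Definition word_mul u v := foldr push v u.
Definition word_inv u := rev (map inv_letter u).

Lemma inv_letterK : involutive inv_letter.
Proof. by case=> i e; rewrite /inv_letter /= negbK. Qed.

Lemma reduced_push a w : reduced w -> reduced (push a w).
Proof.
case: w => //= b w; case: eqP => [_ /path_sorted //|/eqP ab] /= bw.
by rewrite ab.
Qed.

Lemma reduced_mul u v : reduced v -> reduced (word_mul u v).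
Proof. by move=> rv; elim: u => //= a u; apply: reduced_push. Qed.

Lemma reduced_inv u : reduced u -> reduced (word_inv u).
Proof.
rewrite /reduced /word_inv rev_sorted sorted_map; apply: sub_sorted => a b.
by apply: contra => /eqP /= ->; rewrite inv_letterK.
Qed.

Lemma pushK a w : reduced w -> push a (push (inv_letter a) w) = w.
Proof.
case: w => [|b w] /=; first by rewrite eqxx.
rewrite inv_letterK; case: eqP => [-> |_ _]; last by rewrite /= eqxx.
by case: w => //= c w /andP[/negPf ->].
Qed.

Lemma word_mul_push a u v : reduced v ->
  word_mul (push a u) v = push a (word_mul u v).
Proof.
move=> rv; case: u => //= b u; case: eqP => //= ->.
by rewrite pushK //; apply: reduced_mul.
Qed.

Lemma word_mulA u v w : reduced w ->
  word_mul u (word_mul v w) = word_mul (word_mul u v) w.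
Proof. by move=> rw; elim: u => //= a u ->; rewrite word_mul_push. Qed.

Lemma word_mul0 u : reduced u -> word_mul u [::] = u.
Proof.
elim: u => //= a u IHu ru; rewrite IHu; last exact: path_sorted ru.
by case: u ru {IHu} => //= b u /andP[/negPf ->].
Qed.

Lemma word_mulV u : word_mul u (word_inv u) = [::].
Proof.
rewrite /word_inv; elim/last_ind: u => //= u a IHu.
by rewrite map_rcons rev_rcons /word_mul -cats1 foldr_cat /= eqxx.
Qed.

Lemma word_invK : involutive word_inv.
Proof.
by move=> u; rewrite /word_inv map_rev revK mapK //; apply: inv_letterK.
Qed.

Record free_group := FreeGroup {
  fg_word :> seq ('I_d * bool);
  _ : reduced fg_word
}.

HB.instance Definition _ := [isSub for fg_word].
HB.instance Definition _ := [Countable of free_group by <:].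

Lemma fg_reduced (g : free_group) : reduced g.
Proof. exact: valP. Qed.

Definition fg_one := @FreeGroup [::] isT.
Definition fg_mul (g h : free_group) :=
  FreeGroup (reduced_mul g (fg_reduced h)).
Definition fg_inv (g : free_group) := FreeGroup (reduced_inv (fg_reduced g)).

Fact fg_mulA : associative fg_mul.
Proof. by move=> g h k; apply/val_inj/word_mulA/fg_reduced. Qed.

Fact fg_mul1g : left_id fg_one fg_mul.
Proof. by move=> g; apply/val_inj. Qed.

Fact fg_mulg1 : right_id fg_one fg_mul.
Proof. by move=> g; apply/val_inj/word_mul0/fg_reduced. Qed.

Fact fg_mulgV : right_inverse fg_one fg_inv fg_mul.
Proof. by move=> g; apply/val_inj/word_mulV. Qed.

Fact fg_mulVg : left_inverse fg_one fg_inv fg_mul.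
Proof.
by move=> g; apply/val_inj; rewrite /= -{2}(word_invK g) word_mulV.
Qed.

HB.instance Definition _ := isGroup.Build free_group
  fg_mulA fg_mul1g fg_mulg1 fg_mulVg fg_mulgV.

Definition fg_gen (i : 'I_d) : free_group := @FreeGroup [:: (i, true)] isT.

Definition fg_gens : set free_group :=
  [set g | exists i, g = fg_gen i \/ g = (fg_gen i)^-1%g].

End FreeGroup.

Lemma fg_gens_finite d : finite_set (@fg_gens d).
Proof.
apply: (@sub_finite_set _ _
  ((@fg_gen d @` setT) `|` ((fun i => (@fg_gen d i)^-1%g) @` setT))).
  by move=> g [i [->|->]]; [left|right]; exists i.
by rewrite finite_setU; split; apply: finite_image; apply: finite_finset.
Qed.

Lemma fg_gens_inv d (s : free_group d) : fg_gens s -> fg_gens s^-1%g.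
Proof. by move=> [i [->|->]]; exists i; [right|left; rewrite invgK]. Qed.

Lemma fg_gens_generate d (P : free_group d -> Prop) :
  P 1%g -> (forall s g, fg_gens s -> P g -> P (s * g)%g) -> forall g, P g.
Proof.
move=> P1 PM [w rw]; elim: w rw => [|a w IHw] rw.
  by rewrite (_ : FreeGroup rw = 1%g) //; apply/val_inj.
have rw' : reduced w := path_sorted rw.
have ra : reduced [:: a] by [].
have -> : FreeGroup rw = (FreeGroup ra * FreeGroup rw')%g.
  apply/val_inj => /=; rewrite /push.
  by case: (w) rw => //= b u /andP[/negPf ->].
apply: PM => //; exists a.1.
by case: a ra {rw} => i [] ra; [left|right]; apply/val_inj.
Qed.

Lemma free_group_universal d (G : groupType) (f : 'I_d -> G) :
  exists! phi : free_group d -> G,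
    {morph phi : g h / (g * h)%g} /\ (forall i, phi (fg_gen i) = f i).
Proof.
pose l (a : 'I_d * bool) : G := if a.2 then f a.1 else (f a.1)^-1%g.
pose ev (w : seq ('I_d * bool)) : G := foldr (fun a x => (l a * x)%g) 1%g w.
have lV a : l (inv_letter a) = (l a)^-1%g.
  by case: a => i [] //=; rewrite /l /= invgK.
have evP a w : ev (push a w) = (l a * ev w)%g.
  by case: w => //= b w; case: eqP => //= ->; rewrite lV mulVKg.
exists (fun g => ev g); split; last move=> psi [psiM psig].
  split=> [g h|i]; last by rewrite /= /l /= mulg1.
  rewrite /= /word_mul; elim: (fg_word g) => [|a u IHu] /=.
    by rewrite mul1g.
  by rewrite evP IHu mulgA.
have psi1 : psi 1%g = 1%g by apply: (mulgI (psi 1%g)); rewrite -psiM !mulg1.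
have psiV g : psi g^-1%g = (psi g)^-1%g.
  by apply: (mulgI (psi g)); rewrite -psiM !mulgV.
apply/funext => -[w rw] /=; elim: w rw => [|a w IHw] rw.
  by rewrite /ev /= -psi1; congr psi; apply/val_inj.
have rw' : reduced w := path_sorted rw.
have ra : reduced [:: a] by [].
have -> : FreeGroup rw = (FreeGroup ra * FreeGroup rw')%g.
  apply/val_inj => /=; rewrite /push.
  by case: (w) rw => //= b u /andP[/negPf ->].
rewrite psiM -IHw /=; congr (_ * _)%g; rewrite /l.
case: a ra {rw} => i [] ra /=.
  by rewrite -psig; congr psi; apply/val_inj.
by rewrite -psig -psiV; congr psi; apply/val_inj.
Qed.

Definition bimeasurable_bijection d1 d2 (X : measurableType d1)
    (Y : measurableType d2) (f : X -> Y) :=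
  [/\ bijective f, measurable_fun setT f &
      forall A, measurable A -> measurable (f @` A)].

(* [X] is Borel isomorphic to a Polish space; a Hausdorff complete pseudometric
   space is completely metrizable. *)
Definition standard_borel (R : realType) d (X : measurableType d) :=
  exists P : completePseudoMetricType R,
    [/\ hausdorff_space P,
        (exists2 D : set P, countable D & dense D) &
        exists f : X -> g_sigma_algebraType (@open P),
          bimeasurable_bijection f].

Section Actions.
Context {R : realType}.

Record pmp_action (G : groupType) d (X : measurableType d)
    (mu : probability X R) (alpha : G -> X -> X) : Prop := PmpAction {
  pmp_standard : standard_borel R X;
  pmp_act1 : forall x, alpha 1%g x = x;
  pmp_actM : forall g h x, alpha (g * h)%g x = alpha g (alpha h x);
  pmp_bimeasurable : forall g, bimeasurable_bijection (alpha g);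
  pmp_preserving : forall g A, measurable A ->
    pushforward mu (alpha g) A = mu A
}.

Definition invariant_set (G : groupType) (X : Type) (alpha : G -> X -> X)
  (A : set X) := forall g, alpha g @` A = A.

Definition ergodic (G : groupType) d (X : measurableType d)
    (mu : probability X R) (alpha : G -> X -> X) :=
  forall A, measurable A -> invariant_set alpha A ->
    mu A = 0%E \/ mu A = 1%E.

Definition mixing (G : groupType) d (X : measurableType d)
    (mu : probability X R) (alpha : G -> X -> X) :=
  forall A B, measurable A -> measurable B ->
    mu ((alpha g @` A) `&` B) @[g --> (@frechet_filter G : set_system G)] --> (mu A * mu B)%E.

(* Number of edges of a shortest path; [+oo] when there is no path, as the
   infimum of the empty set. *)
Definition graph_dist (T : Type) (E : T -> T -> Prop) (x y : T) : \bar R :=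
  ereal_inf [set (n%:R%R : R)%:E | n in [set n | exists p : nat -> T,
    [/\ p 0%N = x, p n = y & forall i, (i < n)%N -> E (p i) (p i.+1)]]].

Definition action_dist (G : groupType) (X : Type) (S : set G)
    (alpha : G -> X -> X) : X -> X -> \bar R :=
  graph_dist (fun x x' => exists2 s, S s & alpha s x = x').

Definition isometric_orbit_equivalent (G L : groupType) (SG : set G)
    (SL : set L) d1 d2 (X : measurableType d1) (Y : measurableType d2)
    (mu : probability X R) (nu : probability Y R)
    (alpha : G -> X -> X) (beta : L -> Y -> Y) :=
  exists (Phi : X -> Y) (X0 : set X),
    [/\ bimeasurable_bijection Phi,
        (forall B, measurable B -> pushforward mu Phi B = nu B),
        [/\ measurable X0, mu X0 = 1%E & invariant_set alpha X0],
        invariant_set beta (Phi @` X0) &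
        forall x x', X0 x -> X0 x' ->
          action_dist SL beta (Phi x) (Phi x') = action_dist SG alpha x x'].

End Actions.

(* Main.v *)
Require Import Defs.
From HB Require Import structures.
From mathcomp Require Import all_boot all_order all_fingroup all_algebra.
From mathcomp Require Import all_classical all_reals all_analysis.
From mathcomp Require Import ring lra zify.

Set Implicit Arguments.
Unset Strict Implicit.
Unset Printing Implicit Defensive.

Import Order.TTheory GRing.Theory Num.Theory.
Import numFieldNormedType.Exports.

Local Open Scope classical_set_scope.
Local Open Scope ring_scope.

(** The action [beta] is a finite extension of a Bernoulli shift, and [alpha]
    walks along the same edges after a random renaming of the generators.

    Write [L] for the [2 d] letters [x_i^{+-1}], seen as the group
    [Z/d x Z/2], in which the inverse of a letter is its translate by [(0, 1)].
    A renaming of the Cayley tree gives every oriented edge a new letter so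
    that opposite orientations get inverse letters and that the [2 d] edges
    leaving a vertex get all the letters.  If the new letter of the edge [s] at
    the vertex [v] is sought in the form [t_v + pi_v(s)], where the [pi_v] are
    independent uniform permutations of [L], then the compatibility along an
    edge determines [t] at one end from [t] at the other end by a translation.
    Hence [t] at the root is one extra coordinate, uniform in a finite group,
    and moving the root along the edge [s] is a skew product over the Bernoulli
    shift ([step]).  To every new letter is also attached a colour in [Z/2],
    chosen at each vertex as a function of the axis of the new letter; the fibre
    becomes [G = L x Z/2].

    The action [beta] moves the root along the edge with a given old letter;
    [alpha] moves it along the edge with a given new letter
    ([renamed_step]).  Since a free group acts through arbitrary bijections,
    both are actions, and since at each point the generators of one follow the
    edges of the generators of the other, the identity map is an isometric
    orbit equivalence.

    [alpha] is not mixing: a line whose edges all carry the new letter [t] has a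
    single colour, so the colour of that line through the root is an [alpha(t)]
    invariant function, equal to each of its two values with probability [1/2].

    [beta] is mixing.  Along a reduced word the fibre coordinate is displaced by
    a sum in which an interior vertex [v] of the path, entered through [s^-1]
    and left through [s'], contributes
    [lab (x v) s' - lab (x v) s] with [s != s'].  These terms are independent,
    and their law is spread out enough for the convolution by it to contract
    oscillations by a fixed factor ([lab_spreading],
    [convolution_contracts]).  Two events determined by finitely many
    coordinates see only boundedly many of these vertices, so the displacement
    is equidistributed given both events ([displacement_equidistribution]),
    which are themselves independent as soon as the word is long; this is mixing
    on a generating algebra ([finitary_correlation]), and a
    lambda-system argument extends it ([cvg_from_generators]).  Mixing implies
    ergodicity, and ergodicity only depends on the orbits.

    The Bernoulli measure is the law of the digits of a uniform real; its only
    property in use is that a coordinate is uniform given all the others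
    ([bernoulli_indep]), which comes from translation invariance. *)

(** * Probabilities of finite partitions *)

Section RealProbability.
Context {R : realType} d (T : measurableType d) (P : probability T R).

Definition pr (A : set T) : R := fine (P A).

Lemma prE A : measurable A -> (pr A)%:E = P A.
Proof. by move=> mA; rewrite fineK// fin_num_measure. Qed.

Lemma pr_ge0 A : 0 <= pr A.
Proof. exact/fine_ge0/measure_ge0. Qed.

Lemma pr_le A B : measurable A -> measurable B -> A `<=` B -> pr A <= pr B.
Proof.
by move=> mA mB AB; rewrite -lee_fin !prE// le_measure// ?inE.
Qed.

Lemma pr_setT : pr setT = 1.
Proof. by rewrite /pr probability_setT. Qed.

Lemma pr_set0 : pr set0 = 0.
Proof. by rewrite /pr measure0. Qed.

Lemma prU A B : measurable A -> measurable B -> A `&` B = set0 ->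
  pr (A `|` B) = pr A + pr B.
Proof.
move=> mA mB AB; rewrite /pr measureU// fineD// fin_num_measure//.
Qed.

Lemma prC A : measurable A -> pr (~` A) = 1 - pr A.
Proof.
move=> mA; rewrite -pr_setT -(setUv A) prU ?setICr//; last exact: measurableC.
by rewrite addrAC subrr add0r.
Qed.

Lemma pr_partition (F : finType) (f : T -> F) (A : set T) : measurable A ->
  (forall b, measurable [set x | f x = b]) ->
  pr A = \sum_b pr (A `&` [set x | f x = b]).
Proof.
move=> mA mf; suff H (s : seq F) : uniq s ->
    measurable [set x | f x \in s] /\
    pr (A `&` [set x | f x \in s]) = \sum_(b <- s) pr (A `&` [set x | f x = b]).
  have [_] := H _ (enum_uniq F); rewrite [in RHS]big_enum => /= <-.
  by congr pr; apply/seteqP; split=> [x Ax|x []//]; split=> //=; rewrite mem_enum.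
elim: s => [_|b s IHs /= /andP[bs /IHs[ms IH]]].
  rewrite big_nil (_ : [set _ | _] = set0) ?setI0 ?pr_set0; first by split.
  by rewrite -subset0 => x /=; rewrite in_nil.
have -> : [set x | f x \in b :: s] = [set x | f x = b] `|` [set x | f x \in s].
  apply/seteqP; split=> x /=; rewrite in_cons.
    by case/orP=> [/eqP|]; [left|right].
  by case=> [->|->]; rewrite ?eqxx ?orbT.
split; first exact: measurableU.
rewrite big_cons setIUr prU ?IH//; [exact: measurableI..|].
by rewrite -subset0 => x [[_ /= ->] [_ /=]]; apply/negP.
Qed.

End RealProbability.

(** * Fair digits of a uniform real *)

Section Translation.
Variable R : realType.
Local Notation leb := (@lebesgue_measure R).

Lemma measurable_translate (c : R) :
  measurable_fun setT ((fun x => x + c) : measurableTypeR R -> measurableTypeR R).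
Proof. by apply: measurable_realfun.measurable_funD. Qed.

Lemma lebesgue_translate (c : R) (A : set (measurableTypeR R)) :
  measurable A -> leb ((fun x => x + c) @^-1` A) = leb A.
Proof.
move=> mA; symmetry; have mc := measurable_translate c.
pose g : measurableTypeR R -> measurableTypeR R := fun x => x + c.
apply: (@lebesgue_measure_unique R (pushforward leb g)) => // X.
move=> /ocitvP[->|[[a b] /= ab ->]]; first by rewrite !measure0.
rewrite /= /pushforward (_ : _ @^-1` _ = `]a - c, b - c]%classic).
  rewrite !lebesgue_measure_itv /= !lte_fin ltrD2r ab.
  by rewrite -!EFinB; congr EFin; lra.
by apply/seteqP; split=> x /=; rewrite !in_itv /= ltrBlDr lerBrDr.
Qed.

End Translation.

Section Digits.
Variables (R : realType) (N : nat).
Hypothesis N0 : (0 < N)%N.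
Local Notation leb := (@lebesgue_measure R).

Definition digit (k : nat) (x : R) : nat := (Num.truncn (x * N%:R ^+ k.+1) %% N)%N.

Let NR0 k : 0 < N%:R ^+ k :> R.
Proof. by rewrite exprn_gt0// ltr0n. Qed.

Lemma truncn_div (x : R) n : 0 <= x -> (0 < n)%N ->
  Num.truncn (x / n%:R) = (Num.truncn x %/ n)%N.
Proof.
move=> x0 n0; have n0R : 0 < n%:R :> R by rewrite ltr0n.
apply/truncn_def; have /andP[xl xr] := truncn_itv x0.
rewrite ler_pdivlMr// ltr_pdivrMr// -!natrM; apply/andP; split.
  by apply: le_trans xl; rewrite ler_nat leq_trunc_div.
by apply: (lt_le_trans xr); rewrite ler_nat ltn_ceil.
Qed.

(** Less significant digits only see a multiple of [N] added to the truncation,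
    and more significant ones are quotients of [truncn (x * N ^ (k + 1))] by
    powers of [N], which do not change because there is no carry. *)
Lemma digit_replace (k j j' : nat) (x : R) : (j' < N)%N ->
  0 <= x < 1 -> digit k x = j ->
  let x' := x + (j'%:R - j%:R) / N%:R ^+ k.+1 in
  [/\ 0 <= x' < 1, digit k x' = j' & forall i, i != k -> digit i x' = digit i x].
Proof.
move=> j'N /andP[x0 x1] dx x'.
pose c := N%:R ^+ k.+1 : R; have c0 : 0 < c := NR0 _.
pose m := Num.truncn (x * c); have mj : (m %% N)%N = j := dx.
have xc0 : 0 <= x * c by rewrite mulr_ge0// ltW.
have /andP[ml mr] := truncn_itv xc0; rewrite -/m in ml mr.
have jm : (j <= m)%N by rewrite -mj leq_mod.
pose y := x - j%:R / c.
have y0 : 0 <= y.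
  by rewrite subr_ge0 ler_pdivrMr//; apply: le_trans ml; rewrite ler_nat.
have xE : x = y + j%:R / c by rewrite subrK.
have x'E : x' = y + j'%:R / c by rewrite /x' {1}xE -/c; ring.
have trE n i : (k <= i)%N ->
    Num.truncn ((y + n%:R / c) * N%:R ^+ i.+1) =
    (Num.truncn (y * N%:R ^+ i.+1)%R + n * N ^ (i - k))%N.
  move=> ki; have -> : (y + n%:R / c) * N%:R ^+ i.+1 =
      (n * N ^ (i - k))%:R + y * N%:R ^+ i.+1.
    rewrite mulrDl addrC; congr (_ + _).
    have iE : i.+1 = (i - k + k.+1)%N by rewrite addnS subnK.
    rewrite [in LHS]iE exprD natrM natrX -/c.
    by rewrite mulrACA mulVf ?mulr1// gt_eqF.
  have yi0 : 0 <= y * N%:R ^+ i.+1 by rewrite mulr_ge0// ltW.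
  by rewrite truncnD ?natrK 1?addnC ?natr_nat// qualifE.
have x'0 : 0 <= x' by rewrite x'E addr_ge0// divr_ge0// ltW.
have mE : m = (Num.truncn (y * c) + j)%N.
  by rewrite /m {1}xE trE// subnn expn0 muln1.
have m'E : Num.truncn (x' * c) = (Num.truncn (y * c) + j')%N.
  by rewrite x'E trE// subnn expn0 muln1.
pose q := (m %/ N)%N.
have qE : Num.truncn (y * c) = (q * N)%N.
  by apply/eqP; rewrite -(eqn_add2r j) -mE {1}(divn_eq m N) mj.
have mltc : (m < N ^ k.+1)%N.
  by rewrite -(ltr_nat R) natrX; apply: (le_lt_trans ml); rewrite gtr_pMl.
have qlt : (q < N ^ k)%N by rewrite /q ltn_divLR// -expnSr.
split.
- rewrite x'0 /=; suff : x' * c < 1 * c by rewrite ltr_pM2r.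
  rewrite mul1r {2}/c -natrX; apply: (lt_le_trans (truncnS_gt _)).
  rewrite ler_nat m'E qE; apply: leq_trans (_ : q.+1 * N <= _)%N.
    by rewrite mulSn addnC -addSn leq_add2r.
  by rewrite expnSr leq_mul2r qlt orbT.
- by rewrite /digit m'E qE modnMDl modn_small.
- move=> i; rewrite neq_ltn => /orP[ik|ki]; last first.
    have [u uE] : exists u, (i - k = u.+1)%N.
      by exists (i - k).-1; rewrite prednK// subn_gt0.
    have modE t n M : ((t + n * (N * M)) %% N = t %% N)%N.
      by rewrite addnC mulnCA mulnC modnMDl.
    by rewrite /digit {1}xE x'E !trE ?(ltnW ki)// uE expnS !modE.
  have trL z : 0 <= z ->
      Num.truncn (z * N%:R ^+ i.+1) = (Num.truncn (z * c)%R %/ N ^ (k - i))%N.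
    move=> z0; rewrite -truncn_div ?expn_gt0 ?N0//; last first.
      by rewrite mulr_ge0// ltW.
    congr Num.truncn; rewrite natrX /c.
    have kE : k.+1 = (i.+1 + (k - i))%N by rewrite addSn subnKC// ltnW.
    by rewrite kE exprD mulrA mulfK// gt_eqF.
  have [u uE] : exists u, (k - i = u.+1)%N.
    by exists (k - i).-1; rewrite prednK// subn_gt0.
  rewrite /digit !trL// m'E qE -/m {1}(divn_eq m N) mj -/q uE expnS !divnMA.
  have jN : (j < N)%N by rewrite -mj ltn_mod.
  by rewrite !divnMDl// (divn_small j'N) (divn_small jN).
Qed.

Lemma measurable_digit k j :
  measurable [set x : measurableTypeR R | digit k x = j].
Proof.
have mle n : measurable [set x : measurableTypeR R |
    (Num.truncn (x * N%:R ^+ k.+1)%R <= n)%N].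
  rewrite (_ : [set _ | _] = `]-oo, n.+1%:R / N%:R ^+ k.+1[%classic).
    exact: measurable_itv.
  by apply/seteqP; split=> x /=; rewrite in_itv /= truncn_le_nat ltr_pdivlMr.
have -> : [set x : measurableTypeR R | digit k x = j] =
    \bigcup_(m in [set m | (m %% N)%N = j])
      ([set x : measurableTypeR R | (Num.truncn (x * N%:R ^+ k.+1)%R <= m)%N] `&`
       \bigcap_(n in [set n | (n < m)%N])
        ~` [set x : measurableTypeR R | (Num.truncn (x * N%:R ^+ k.+1)%R <= n)%N]).
  apply/seteqP; split=> x /=.
    move=> dx; exists (Num.truncn (x * N%:R ^+ k.+1)) => //=; split => // n /= nm.
    by apply/negP; rewrite -ltnNge.
  move=> [m /= mj [xm xn]]; rewrite /digit (_ : Num.truncn _ = m)//.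
  apply/eqP; rewrite eqn_leq xm leqNgt; apply/negP => lt.
  by have /= := xn _ lt; apply.
apply: bigcup_measurable => m _; apply: measurableI => //.
have [->|[n]] : m = 0%N \/ exists n, m = n.+1 by case: (m); [left|right; exists n].
  by rewrite (_ : [set n | _] = set0) ?bigcap_set0// -subset0.
move=> ->; apply: bigcap_measurable; first by exists n => /=.
by move=> i _; apply: measurableC.
Qed.

End Digits.

(** * The Bernoulli measure *)

Section Configurations.
Variables (I : choiceType) (B : finType).
Implicit Types (x y : I -> B) (A : set (I -> B)) (V : seq I).

Definition upd x i b : I -> B := fun k => if k == i then b else x k.

Definition determined_by V A := forall x y, {in V, x =1 y} -> A x -> A y.

Definition finitary A := exists V, determined_by V A.

Lemma upd_id x i : upd x i (x i) = x.
Proof. by apply/funext => k; rewrite /upd; case: eqP => [->|]. Qed.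

Lemma upd_upd x i b c : upd (upd x i b) i c = upd x i c.
Proof. by apply/funext => k; rewrite /upd; case: eqP. Qed.

Lemma determined_by_iff V A x y :
  determined_by V A -> {in V, x =1 y} -> A x <-> A y.
Proof. by move=> dA xy; split; apply: dA => // i iV; rewrite xy. Qed.

Lemma determined_by_nil A : determined_by [::] A -> A = setT \/ A = set0.
Proof.
move=> dA; case: (pselect (exists x, A x)) => [[x Ax]|nA]; [left|right].
  by apply/seteqP; split=> // y _; apply: dA Ax.
by rewrite -subset0 => x Ax; apply: nA; exists x.
Qed.

Lemma determined_by_upd V A i b :
  determined_by (i :: V) A -> determined_by V [set x | A (upd x i b)].
Proof.
move=> dA x y xy /=; apply: dA => k; rewrite /upd inE.
by case: eqP => //= _; apply: xy.
Qed.

Arguments determined_by_upd [V A i] b _ _ _ _.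

Lemma determined_by_coord V A i b :
  determined_by (i :: V) A ->
  A `&` [set x | x i = b] = [set x | A (upd x i b)] `&` [set x | x i = b].
Proof. by move=> dA; apply/seteqP; split=> x /= [] + xb; rewrite -xb upd_id. Qed.

Lemma determined_by_sub V V' A :
  {subset V <= V'} -> determined_by V A -> determined_by V' A.
Proof. by move=> VV' dA x y xy; apply: dA => i /VV'; apply: xy. Qed.

Lemma determined_byI V V' A A' : determined_by V A -> determined_by V' A' ->
  determined_by (V ++ V') (A `&` A').
Proof.
move=> dA dA' x y xy [Ax A'x]; split; [apply: dA Ax|apply: dA' A'x] => i iV;
by apply: xy; rewrite mem_cat iV ?orbT.
Qed.

Lemma finitaryI : setI_closed finitary.
Proof.
by move=> A A' [V dA] [V' dA']; exists (V ++ V'); apply: determined_byI.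
Qed.

Lemma finitaryT : finitary setT.
Proof. by exists [::]. Qed.

Lemma finitary_coord i b : finitary [set x | x i = b].
Proof. by exists [:: i] => x y xy /= <-; rewrite xy// inE. Qed.

(** A finitary set is a finite Boolean combination of coordinate conditions;
    the induction fixes one coordinate at a time. *)
Lemma measurable_preimage_finitary d (T : measurableType d) (f : T -> I -> B) A :
  (forall i b, measurable [set t | f t i = b]) -> finitary A ->
  measurable (f @^-1` A).
Proof.
move=> mf [V]; elim: V A => [|i V IHV] A dA.
  by have [->|->] := determined_by_nil dA; rewrite ?preimage_setT ?preimage_set0.
rewrite (_ : f @^-1` A = \bigcup_(b in [set: B])
    ([set t | f t i = b] `&` f @^-1` [set x | A (upd x i b)])).
  apply: fin_bigcup_measurable => [|b _]; first exact: finite_finset.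
  by apply: measurableI => //; exact: (IHV _ (determined_by_upd b dA)).
apply/seteqP; split=> t /=; first by exists (f t i) => //=; rewrite upd_id.
by move=> [b _ /= [<-]]; rewrite upd_id.
Qed.

End Configurations.

Arguments determined_by_upd [I B V A i] b _ _ _ _.

(** The symbol [b0] is carried to provide the base point of a measurable type. *)
Definition config (I : Type) (B : Type) (b0 : B) : Type := I -> B.

HB.instance Definition _ I B b0 := gen_eqMixin (@config I B b0).
HB.instance Definition _ I B b0 := gen_choiceMixin (@config I B b0).
HB.instance Definition _ I B b0 := isPointed.Build (@config I B b0) (fun=> b0).

Definition configM (I : choiceType) (B : finType) (b0 : B) :=
  @g_sigma_algebraType (@config I B b0) (@finitary I B).

HB.instance Definition _ I B b0 := Measurable.on (@configM I B b0).

Section ConfigMeasurability.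
Variables (I : choiceType) (B : finType) (b0 : B).
Local Notation Om := (@configM I B b0).

Lemma measurable_finitary (A : set Om) : finitary A -> measurable A.
Proof. by move=> fA; apply: sub_sigma_algebra. Qed.

Lemma measurable_coord i b : measurable [set x : Om | x i = b].
Proof. by apply: measurable_finitary; exact: finitary_coord. Qed.

Lemma measurable_to_config d (T : measurableType d) (f : T -> Om) :
  (forall i b, measurable [set t | f t i = b]) -> measurable_fun setT f.
Proof.
move=> mf; apply: (@measurability _ _ _ _ setT f (@finitary I B)) => //.
by move=> _ [A fA <-]; rewrite setTI; apply: measurable_preimage_finitary.
Qed.

End ConfigMeasurability.

Section Bernoulli.
Variables (R : realType) (I : countType) (B : finType) (b0 : B).
Local Notation Om := (@configM I B b0).
Local Notation N := #|B|.
Local Notation leb := (@lebesgue_measure R).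
Local Notation U := (`[0, 1[%classic : set (measurableTypeR R)).

Let N0 : (0 < N)%N.
Proof. by apply/card_gt0P; exists b0. Qed.

Definition digits (x : measurableTypeR R) : Om :=
  fun i => nth b0 (enum B) (digit N (pickle i) x).

Lemma digitsE x i b : (digits x i = b) <-> (digit N (pickle i) x = index b (enum B)).
Proof.
split=> [<-|]; last by rewrite /digits => ->; rewrite nth_index// mem_enum.
by rewrite index_uniq ?enum_uniq// -cardE ltn_mod.
Qed.

Lemma measurable_digits : measurable_fun setT digits.
Proof.
apply: measurable_to_config => i b.
rewrite (_ : [set _ | _] = [set x : measurableTypeR R |
    digit N (pickle i) x = index b (enum B)]); first exact: measurable_digit.
by apply/seteqP; split=> x /digitsE.
Qed.

Definition bernoulli (A : set Om) : \bar R := leb (digits @^-1` A `&` U).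

Let mpre A : measurable A -> measurable (digits @^-1` A).
Proof. by move=> mA; rewrite -[_ @^-1` _]setTI; apply: measurable_digits. Qed.

Let bernoulli0 : bernoulli set0 = 0%E.
Proof. by rewrite /bernoulli preimage_set0 set0I measure0. Qed.

Let bernoulli_ge0 A : (0 <= bernoulli A)%E.
Proof. exact: measure_ge0. Qed.

Let bernoulli_sigma_additive : semi_sigma_additive bernoulli.
Proof.
move=> F mF tF mUF; rewrite /bernoulli preimage_bigcup setI_bigcupl.
apply: measure_semi_sigma_additive.
- by move=> n; apply: measurableI; [exact: mpre|exact: measurable_itv].
- apply/trivIsetP => /= i j _ _ ij; rewrite setIACA -preimage_setI.
  by move/trivIsetP : tF => /(_ _ _ _ _ ij) ->//; rewrite preimage_set0 set0I.
- apply: bigcup_measurable => n _.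
  by apply: measurableI; [exact: mpre|exact: measurable_itv].
Qed.

HB.instance Definition _ := isMeasure.Build _ _ _ bernoulli
  bernoulli0 bernoulli_ge0 bernoulli_sigma_additive.

Let bernoulliT : bernoulli setT = 1%E.
Proof.
rewrite /bernoulli preimage_setT setTI lebesgue_measure_itv /= lte_fin ltr01.
by rewrite oppr0 adde0.
Qed.

HB.instance Definition _ := Measure_isProbability.Build _ _ _ bernoulli bernoulliT.

Local Notation P := (pr bernoulli).

Let bernoulli_exchange (A : set Om) i b b' : measurable A ->
  (forall x c, A (upd x i c) <-> A x) ->
  bernoulli (A `&` [set x | x i = b]) = bernoulli (A `&` [set x | x i = b']).
Proof.
move=> mA iA; pose k := pickle i.
pose j := index b (enum B); pose j' := index b' (enum B).
have jN c : (index c (enum B) < N)%N by rewrite cardE index_mem mem_enum.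
pose t : R := (j%:R - j'%:R) / N%:R ^+ k.+1.
have move_set c c' x : (digits @^-1` (A `&` [set x | x i = c]) `&` U) x ->
    let t := ((index c' (enum B))%:R - (index c (enum B))%:R) / N%:R ^+ k.+1 in
    (digits @^-1` (A `&` [set x | x i = c']) `&` U) (x + t).
  rewrite /= !in_itv /= => -[[Ax xc] x01].
  have dx : digit N k x = index c (enum B) by apply/digitsE.
  have [x'01 dx' dk] := digit_replace N0 (jN c') x01 dx.
  have x'c : digits (x + ((index c' (enum B))%:R - (index c (enum B))%:R) /
    N%:R ^+ k.+1) i = c' by apply/digitsE.
  split=> //; split=> //; move/(iA _ c') : Ax; move=> Ax; apply/(iA _ c'); move: Ax.
  suff -> : upd (digits x) i c' = upd (digits (x + ((index c' (enum B))%:R -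
    (index c (enum B))%:R) / N%:R ^+ k.+1)) i c' by [].
  apply/funext => l; rewrite /upd; case: eqP => // /eqP li.
  rewrite /digits dk//; apply: contra li => /eqP.
  by move/(pcan_inj pickleK) => ->.
rewrite /bernoulli.
rewrite -(@lebesgue_translate R t (digits @^-1` (A `&` [set x | x i = b]) `&` U)).
  congr leb; apply/seteqP; split=> x; last exact: move_set.
  move/(@move_set b b') => /=; rewrite (_ : x + t + _ = x)//.
  by rewrite -/j -/j' /t; ring.
apply: measurableI; last exact: measurable_itv.
by apply: mpre; apply: measurableI => //; exact: measurable_coord.
Qed.

(** Exchanging two values of one digit is a translation of a part of the unit
    interval, so all values of a coordinate are equally likely whatever the
    other coordinates do. *)
Lemma bernoulli_indep (A : set Om) i b : measurable A ->
  (forall x c, A (upd x i c) <-> A x) ->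
  P (A `&` [set x | x i = b]) = N%:R^-1 * P A.
Proof.
move=> mA iA; rewrite [in RHS](pr_partition (f := fun x => x i) bernoulli mA).
  rewrite (eq_bigr (fun=> P (A `&` [set x | x i = b]))); last first.
    by move=> c _; congr fine; exact: bernoulli_exchange.
  by rewrite sumr_const -[X in _ * X]mulr_natl mulKf ?pnatr_eq0 -?lt0n.
by move=> c; exact: measurable_coord.
Qed.

End Bernoulli.

(** * Independence of coordinates *)

Section BernoulliFacts.
Variables (R : realType) (I : countType) (B : finType) (b0 : B).
Local Notation Om := (@configM I B b0).
Local Notation N := #|B|.
Local Notation beR := (@bernoulli R I B b0).
Local Notation P := (pr beR).

Let N0 : N%:R != 0 :> R.
Proof. by rewrite pnatr_eq0 -lt0n; apply/card_gt0P; exists b0. Qed.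

Lemma measurable_determined V (A : set Om) : determined_by V A -> measurable A.
Proof. by move=> dA; apply: measurable_finitary; exists V. Qed.

Definition free_of (V : seq I) (A : set Om) :=
  forall i x c, i \in V -> A (upd x i c) <-> A x.

Lemma determined_free V W (A : set Om) : determined_by V A ->
  (forall i, i \in W -> i \notin V) -> free_of W A.
Proof.
move=> dA VW i x c iW; apply: determined_by_iff dA _ => k kV; rewrite /upd.
by case: eqP kV => // -> iV; have := VW _ iW; rewrite iV.
Qed.

Lemma pr_fix_coord (A : set Om) i (C : set Om) V :
  determined_by (i :: V) A -> measurable C -> free_of [:: i] C ->
  P (A `&` C) = N%:R^-1 * \sum_b P ([set x | A (upd x i b)] `&` C).
Proof.
move=> dA mC iC; have mA := measurable_determined dA.
rewrite (@pr_partition _ _ _ _ _ (fun x : Om => x i)); [|exact: measurableI|]; last first.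
  by move=> b; exact: measurable_coord.
rewrite mulr_sumr; apply: eq_bigr => b _.
rewrite setIAC (determined_by_coord _ dA) setIAC bernoulli_indep//.
  apply: measurableI => //.
  by apply: (@measurable_determined V); apply: determined_by_upd dA.
move=> x c /=; rewrite /setI /= upd_upd; split=> -[A1 C1]; split=> //.
  by apply/(iC i x c); rewrite ?inE.
by apply/(iC i x c); rewrite ?inE.
Qed.

(** Fixing the coordinates of [V] one at a time reduces [A] to the empty or
    to the full event, without affecting [C]. *)
Lemma pr_indep V (A C : set Om) : determined_by V A -> measurable C ->
  free_of V C -> P (A `&` C) = P A * P C.
Proof.
move=> + mC; elim: V A => [|i V IHV] A dA fC.
  have [->|->] := determined_by_nil dA; first by rewrite setTI pr_setT mul1r.
  by rewrite set0I pr_set0 mul0r.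
rewrite (pr_fix_coord dA mC); last first.
  by move=> k x c; rewrite inE => /eqP ->; apply: fC; rewrite inE eqxx.
rewrite -[A in RHS]setIT (pr_fix_coord dA) // -mulrA; congr (_ * _).
rewrite mulr_suml; apply: eq_bigr => b _; rewrite setIT; apply: IHV.
  exact: determined_by_upd dA.
by move=> k x c kV; apply: fC; rewrite inE kV orbT.
Qed.

Lemma measurable_reindex (rho : I -> I) :
  measurable_fun setT ((fun x i => x (rho i)) : Om -> Om).
Proof. by apply: measurable_to_config => i b; exact: measurable_coord. Qed.

Lemma pr_reindex_finitary (rho : I -> I) (A : set Om) : injective rho ->
  finitary A -> P [set x | A (fun i => x (rho i))] = P A.
Proof.
move=> rI [V]; elim: V A => [|i V IHV] A dA.
  by have [->|->] := determined_by_nil dA; rewrite ?pr_setT ?pr_set0.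
rewrite -[X in P X]setIT -[in RHS](setIT A) (pr_fix_coord dA)//.
have dA' : determined_by (rho i :: map rho V) [set x | A (fun i => x (rho i))].
  by move=> x y xy; apply: dA => k kV; apply: xy; rewrite -map_cons map_f.
rewrite (pr_fix_coord dA')//; congr (_ * _); apply: eq_bigr => b _.
rewrite !setIT -(IHV _ (determined_by_upd b dA)); congr P.
apply/seteqP; split=> x /=;
  rewrite (_ : upd (fun _ => x _) i b = fun k => upd x (rho i) b (rho k))//.
  by apply/funext => k; rewrite /upd (inj_eq rI).
by apply/funext => k; rewrite /upd (inj_eq rI).
Qed.

Lemma bernoulli_reindex (rho : I -> I) (A : set Om) : injective rho ->
  measurable A -> bernoulli R [set x : Om | A (fun i => x (rho i))] = bernoulli R A.
Proof.
move=> rI mA; have mr := measurable_reindex rho.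
pose h : Om -> Om := fun x i => x (rho i).
symmetry; rewrite -[RHS]/(pushforward beR h A).
apply: (@measure_unique _ R Om (@finitary I B) (fun=> setT) _ _ _ _
  beR (pushforward beR h)) => //.
- exact: finitaryI.
- by move=> _; exact: finitaryT.
- by rewrite bigcup_const//; exists 0%N.
- move=> C fC; have mC := measurable_finitary fC.
  have mC' : measurable (h @^-1` C) by rewrite -[_ @^-1` _]setTI; exact: mr.
  rewrite /= /pushforward -(prE _ mC) -(prE _ mC'); congr EFin; symmetry.
  exact: pr_reindex_finitary.
- by move=> _; rewrite /= probability_setT ltry.
Qed.

(** ** Equidistribution of sums *)

Definition depends_on (T : Type) (V : seq I) (f : Om -> T) :=
  forall x y, {in V, x =1 y} -> f x = f y.

Lemma depends_on_fiber (T : Type) V (f : Om -> T) r :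
  depends_on V f -> determined_by V [set x | f x = r].
Proof. by move=> df x y /df /= ->. Qed.

Arguments depends_on_fiber [T V f] r _ _ _ _ _.

Variable G : finZmodType.

(** The form in which non-degeneracy of the law of [delta] is used: any two
    translates of that law have a common atom. *)
Definition spreading (delta : B -> G) :=
  forall z, exists b b', delta b - delta b' = z.

(** The two averages share a term: with [delta c - delta c' = r - r'], the term
    of index [c] of the first one equals the term of index [c'] of the second
    one.  The other [N - 1] differences are at most [M]. *)
Lemma convolution_contracts (delta : B -> G) (q : G -> R) (M : R) :
  spreading delta -> (forall r r', q r - q r' <= M) ->
  forall r r', N%:R^-1 * (\sum_b q (r - delta b)) -
               N%:R^-1 * (\sum_b q (r' - delta b)) <= (1 - N%:R^-1) * M.
Proof.
move=> sd qM r r'; have [c [c' cc']] := sd (r - r').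
rewrite -mulrBr [X in _ - X](reindex_inj (@perm_inj _ (tperm c c'))) /= -sumrB.
(* after exchanging the indices c and c' in the second sum *)
rewrite (bigD1 c)//= tpermL (_ : r - delta c = r' - delta c'); last first.
  by apply/eqP; rewrite subr_eq -addrA [- _ + _]addrC cc' addrC subrK.
rewrite subrr add0r.
apply: le_trans (_ : N%:R^-1 * (\sum_(i | i != c) M) <= _).
  by rewrite ler_wpM2l ?invr_ge0// ler_sum.
rewrite sumr_const cardC1 -[X in _ * X <= _]mulr_natl mulrA ler_wpM2r//.
  by have := qM r r; rewrite subrr.
by rewrite -subn1 natrB ?mulrBr ?mulVf ?mulr1// lt0n -(pnatr_eq0 R).
Qed.

(** Conditioning on the coordinate [v] turns the law of the sum into the
    convolution of the law of the remaining sum by the law of [delta v]. *)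
Lemma sum_oscillation (vs : seq I) (delta : I -> B -> G) V (Psi : Om -> G)
    (C : set Om) :
  uniq vs -> (forall v, v \in vs -> spreading (delta v)) ->
  depends_on V Psi -> (forall v, v \in vs -> v \notin V) ->
  measurable C -> free_of vs C ->
  forall r r',
    P (C `&` [set x | Psi x + \sum_(v <- vs) delta v (x v) = r]) -
    P (C `&` [set x | Psi x + \sum_(v <- vs) delta v (x v) = r']) <=
    (1 - N%:R^-1) ^+ size vs.
Proof.
move=> + + dP + mC.
have dep vs' : depends_on (V ++ vs') (fun x => Psi x + \sum_(v <- vs') delta v (x v)).
  move=> x y xy; congr (_ + _).
    by apply: dP => i iV; apply: xy; rewrite mem_cat iV.
  by apply: eq_big_seq => v vV; rewrite xy// mem_cat vV orbT.
have mdep vs' r : measurable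
    [set x : Om | Psi x + \sum_(v <- vs') delta v (x v) = r].
  by apply: (@measurable_determined (V ++ vs')); apply: depends_on_fiber.
elim: vs => [_ _ _ _|v vs IHvs /= /andP[vvs uvs] sd vV fC].
  move=> r r'; rewrite expr0.
  have p1 : P (C `&` [set x | Psi x + \sum_(v <- [::]) delta v (x v) = r]) <= 1.
    by rewrite -(pr_setT beR) pr_le//; apply: measurableI => //; exact: mdep.
  by apply: le_trans p1; rewrite gerBl pr_ge0.
pose q r := P (C `&` [set x | Psi x + \sum_(w <- vs) delta w (x w) = r]).
have qE r : P (C `&` [set x | Psi x + \sum_(w <- v :: vs) delta w (x w) = r]) =
    N%:R^-1 * \sum_b q (r - delta v b).
  rewrite (@pr_partition _ _ _ _ _ (fun x : Om => x v)); first last.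
  - by move=> b; exact: measurable_coord.
  - by apply: measurableI => //; exact: mdep.
  rewrite mulr_sumr; apply: eq_bigr => b _.
  pose E := C `&` [set x : Om | Psi x + \sum_(w <- vs) delta w (x w) = r - delta v b].
  transitivity (P (E `&` [set x | x v = b])); last first.
    rewrite bernoulli_indep//; first by apply: measurableI => //; exact: mdep.
    move=> x c; have vin : v \in v :: vs by rewrite inE eqxx.
    have fP : free_of [:: v]
        [set x | Psi x + \sum_(w <- vs) delta w (x w) = r - delta v b].
      apply: (determined_free (depends_on_fiber _ (dep vs))) => i.
      rewrite inE => /eqP ->.
      by rewrite mem_cat negb_or vV.
    have := fP v x c; rewrite inE eqxx => /(_ isT) h1; have h2 := fC v x c vin.
    by rewrite /E /setI /= in h1 *; tauto.
  congr P; apply/seteqP; split=> x /= [[Cx xr] xv]; split=> //; split=> //; move: xr.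
    by rewrite big_cons xv => <-; rewrite addrCA (addrC (delta v b)) addrK.
  by rewrite big_cons xv addrCA => ->; rewrite addrC subrK.
move=> r r'; rewrite !qE exprS; apply: convolution_contracts.
  by apply: sd; rewrite inE eqxx.
apply: IHvs => // [w wvs|w wvs|w x c wvs].
- by apply: sd; rewrite inE wvs orbT.
- by apply: vV; rewrite inE wvs orbT.
- by apply: fC; rewrite inE wvs orbT.
Qed.

Lemma sum_equidistribution (vs : seq I) (delta : I -> B -> G) V (Psi : Om -> G)
    (C : set Om) :
  uniq vs -> (forall v, v \in vs -> spreading (delta v)) ->
  depends_on V Psi -> (forall v, v \in vs -> v \notin V) ->
  measurable C -> free_of vs C ->
  forall r, `|P (C `&` [set x | Psi x + \sum_(v <- vs) delta v (x v) = r]) -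
              #|G|%:R^-1 * P C| <= (1 - N%:R^-1) ^+ size vs.
Proof.
move=> uvs sd dP vV mC fC r; have osc := sum_oscillation uvs sd dP vV mC fC.
have G0 : #|G|%:R != 0 :> R.
  by rewrite pnatr_eq0 -lt0n; apply/card_gt0P; exists 0.
pose f x := Psi x + \sum_(v <- vs) delta v (x v).
have mf r' : measurable [set x : Om | f x = r'].
  apply: (@measurable_determined (V ++ vs)); apply: depends_on_fiber => x y xy.
  congr (_ + _); first by apply: dP => i iV; apply: xy; rewrite mem_cat iV.
  by apply: eq_big_seq => v vvs; rewrite xy// mem_cat vvs orbT.
rewrite [in X in _ - X](pr_partition (f := f) beR mC)//.
set q := fun r => P (C `&` [set x | f x = r]).
rewrite -[X in `|X - _|]/(q r) (_ : q r = #|G|%:R^-1 * \sum_(s : G) q r); last first.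
  by rewrite sumr_const -[X in _ * X]mulr_natl mulKf.
rewrite -mulrBr -sumrB normrM ger0_norm ?invr_ge0//.
apply: le_trans (_ : #|G|%:R^-1 * (\sum_(s : G) (1 - N%:R^-1) ^+ size vs) <= _).
  rewrite ler_wpM2l ?invr_ge0//; apply: le_trans (ler_norm_sum _ _ _) _.
  by apply: ler_sum => s _; rewrite ler_norml lerNl opprB !osc.
by rewrite sumr_const -[X in _ * X]mulr_natl mulKf.
Qed.

End BernoulliFacts.

Arguments depends_on_fiber [I B b0 T V f] r _ _ _ _ _.

(** * Convergence from generators to the sigma-algebra *)

Section ConvergenceFromGenerators.
Variables (R : realType) (d : measure_display) (T : measurableType d).
Variables (mu : probability T R) (K : Type) (F : set_system K) (f : K -> T -> T).
Variables (B : K -> set T) (c : R) (G : set (set T)).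
Context {FF : Filter F}.
Hypotheses (mf : forall k, measurable_fun setT (f k)) (mB : forall k, measurable (B k)).
Hypothesis fmu : forall k A, measurable A -> mu (f k @^-1` A) = mu A.
Hypothesis c01 : `|c| <= 1.
Hypotheses (GT : G setT) (GI : setI_closed G) (mG : measurable = <<s G >>).

Let nu k A := pr mu (f k @^-1` A `&` B k).

Let mpre k A : measurable A -> measurable (f k @^-1` A).
Proof. by move=> mA; rewrite -[_ @^-1` _]setTI; apply: mf. Qed.

Let nuU k A A' : measurable A -> measurable A' -> A `&` A' = set0 ->
  nu k (A `|` A') = nu k A + nu k A'.
Proof.
move=> mA mA' AA'; rewrite /nu preimage_setU setIUl prU//.
- by apply: measurableI => //; exact: mpre.
- by apply: measurableI => //; exact: mpre.
- by rewrite setIACA -preimage_setI AA' preimage_set0 set0I.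
Qed.

Let nu_le k A : measurable A -> nu k A <= pr mu A.
Proof.
move=> mA; rewrite /nu [leRHS](_ : _ = pr mu (f k @^-1` A)); last first.
  by rewrite /pr fmu.
apply: pr_le => //; last exact: mpre.
by apply: measurableI => //; exact: mpre.
Qed.

Let nu_ge0 k A : 0 <= nu k A.
Proof. exact: pr_ge0. Qed.

(** The class of good sets is a lambda-system: since [nu k <= mu], the tail of
    a countable disjoint union is negligible uniformly in [k]. *)
Lemma cvg_from_generators :
  (forall A, G A -> nu k A @[k --> F] --> c * pr mu A) ->
  forall A, measurable A -> nu k A @[k --> F] --> c * pr mu A.
Proof.
move=> GC A; rewrite mG; move: A.
apply: (@dynkin_induction _ T G [set A | nu k A @[k --> F] --> c * pr mu A] mG GI) => /=;
  [exact: GC|exact: GC|..].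
- move=> S mS cS; rewrite prC// mulrBr mulr1.
  have -> : (fun k => nu k (~` S)) = (fun k => nu k setT - nu k S).
    apply/funext => k; rewrite -(setvU S) nuU//; last by rewrite setICl.
      by rewrite addrK.
    exact: measurableC.
  apply: cvgB => //; rewrite -[c in X in _ --> X]mulr1 -(pr_setT mu).
  exact: GC.
- move=> S mS tS cS; set U := \bigcup_k S k.
  have mU : measurable U by exact: bigcupT_measurable.
  pose W n := \big[setU/set0]_(i < n) S i.
  have mW n : measurable (W n) by exact: bigsetU_measurable.
  have WS n : W n `&` S n = set0.
    rewrite -subset0 /W -bigcup_mkord => x [[i /= ni Six] Sx].
    have ni' : i != n by rewrite neq_ltn ni.
    have /seteqP[sub _] := (trivIsetP.1 tS) i n I I ni'.
    exact: sub x (conj Six Sx).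
  have WU n : W n `<=` U by rewrite /W -bigcup_mkord => x [i _ Six]; exists i.
  have cW n : nu k (W n) @[k --> F] --> c * pr mu (W n).
    elim: n => [|n IHn].
      rewrite /W big_ord0 pr_set0 mulr0 (_ : (fun k => nu k set0) = cst 0); first exact: cvg_cst.
      by apply/funext => k; rewrite /nu preimage_set0 set0I pr_set0.
    have WE : W n.+1 = W n `|` S n by rewrite /W big_ord_recr.
    rewrite WE prU// mulrDr (_ : (fun k => nu k _) = (fun k => nu k (W n) + nu k (S n))).
      exact: cvgD.
    by apply/funext => k; rewrite nuU.
  have tail n : pr mu (U `\` W n) = pr mu U - pr mu (W n).
    rewrite -[in X in X - _](setDUK (WU n)) prU//; last by rewrite setDIK.
      by rewrite addrAC subrr add0r.
    exact: measurableD.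
  have cpr : pr mu (W n) @[n --> \oo] --> pr mu U.
    have -> : (fun n => pr mu (W n)) = (fun n => fine (mu (W n))) by [].
    apply: fine_cvg; rewrite -[pr mu U]/(fine (mu U)) fineK ?fin_num_measure//.
    have -> : (fun n => mu (W n)) = (fun n => \sum_(0 <= i < n) mu (S i))%E.
      by apply/funext => n; rewrite /W measure_bigsetU// big_mkord.
    exact: measure_sigma_additive.
  apply/cvgrPdist_lt => e e0.
  have e3 : 0 < e / 3 by rewrite divr_gt0.
  have [n Hn] : exists n, pr mu U - pr mu (W n) < e / 3.
    have /cvgrPdist_lt/(_ _ e3)[n _ /(_ n (leqnn n))] := cpr.
    by move=> /ltr_normlW; exists n.
  have /cvgrPdist_lt/(_ _ e3) := cW n.
  apply: filterS => k /=; rewrite !ltr_norml => /andP[h1 h2].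
  have UE : U = W n `|` (U `\` W n) by rewrite setDUK.
  have t1 : nu k U = nu k (W n) + nu k (U `\` W n).
    rewrite {1}UE nuU//; first exact: measurableD.
    by rewrite setDIK.
  have t2 : nu k (U `\` W n) <= pr mu U - pr mu (W n).
    by rewrite -tail nu_le//; exact: measurableD.
  have t3 := nu_ge0 k (U `\` W n).
  have t4 : `|c * pr mu U - c * pr mu (W n)| <= pr mu U - pr mu (W n).
    rewrite -mulrBr normrM -tail (ger0_norm (pr_ge0 _ _)).
    by rewrite -[leRHS]mul1r ler_wpM2r// pr_ge0.
  move: t4; rewrite ler_norml => /andP[t4 t5].
  by apply/andP; split; lra.
Qed.

End ConvergenceFromGenerators.

(** * Bernoulli times a uniform finite fibre *)

Definition skewprod (I B : Type) (b0 : B) (G : zmodType) : Type :=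
  (@config I B b0 * G)%type.

HB.instance Definition _ I B b0 G := gen_eqMixin (@skewprod I B b0 G).
HB.instance Definition _ I B b0 G := gen_choiceMixin (@skewprod I B b0 G).
HB.instance Definition _ I B b0 G := isPointed.Build (@skewprod I B b0 G) (fun=> b0, 0).

Definition skew_finitary (I : choiceType) (B : finType) (G : Type)
    (A : set ((I -> B) * G)) :=
  forall r, finitary [set x | A (x, r)].

Definition skewM (I : choiceType) (B : finType) (b0 : B) (G : finZmodType) :=
  @g_sigma_algebraType (@skewprod I B b0 G) (@skew_finitary I B G).

HB.instance Definition _ I B b0 G := Measurable.on (@skewM I B b0 G).

Section Skew.
Variables (I : choiceType) (B : finType) (b0 : B) (G : finZmodType).
Local Notation Om := (@configM I B b0).
Local Notation X := (@skewM I B b0 G).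

Lemma skew_finitaryI : setI_closed (@skew_finitary I B G).
Proof. by move=> A A' fA fA' r; apply: (finitaryI (fA r) (fA' r)). Qed.

Lemma skew_finitaryT : skew_finitary (setT : set X).
Proof. by move=> r; exact: finitaryT. Qed.

Lemma measurable_skew_finitary (A : set X) : skew_finitary A -> measurable A.
Proof. by move=> fA; apply: sub_sigma_algebra. Qed.

Lemma measurable_fibre (r : G) : measurable_fun setT ((fun x => (x, r)) : Om -> X).
Proof.
apply: (@measurability _ _ Om X setT _ (@skew_finitary I B G)) => //.
by move=> _ [A fA <-]; rewrite setTI; apply: measurable_finitary; exact: fA.
Qed.

Lemma measurable_slice (A : set X) r :
  measurable A -> measurable [set x : Om | A (x, r)].
Proof.
by move=> mA; rewrite -[X in measurable X]setTI; exact: (measurable_fibre r).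
Qed.

Lemma measurable_to_skew d (T : measurableType d) (f : T -> X) :
  (forall i b, measurable [set t | (f t).1 i = b]) ->
  (forall r, measurable [set t | (f t).2 = r]) -> measurable_fun setT f.
Proof.
move=> mf mr; apply: (@measurability _ _ T X setT f (@skew_finitary I B G)) => //.
move=> _ [A fA <-]; rewrite setTI.
rewrite (_ : f @^-1` A = \bigcup_(r in [set: G])
   ([set t | (f t).2 = r] `&` (fun t => (f t).1) @^-1` [set x | A (x, r)])).
  apply: fin_bigcup_measurable => [|r _]; first exact: finite_finset.
  by apply: measurableI => //; exact: measurable_preimage_finitary.
apply/seteqP; split=> t /=; first by exists (f t).2 => //=; rewrite -surjective_pairing.
by move=> [r _ /= [<-]]; rewrite -surjective_pairing.
Qed.

Lemma measurable_skew_coord i b : measurable [set x : X | x.1 i = b].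
Proof. by apply: measurable_skew_finitary => r; exact: finitary_coord. Qed.

End Skew.

Section SkewMeasure.
Variables (R : realType) (I : countType) (B : finType) (b0 : B) (G : finZmodType).
Local Notation Om := (@configM I B b0).
Local Notation X := (@skewM I B b0 G).
Local Notation beR := (@bernoulli R I B b0).

Definition fibre_measure (r : G) (A : set X) : \bar R := beR [set x | A (x, r)].

Section Fibre.
Variable r : G.

Let fibre_measure0 : fibre_measure r set0 = 0%E.
Proof. by rewrite /fibre_measure measure0. Qed.

Let fibre_measure_ge0 A : (0 <= fibre_measure r A)%E.
Proof. exact: measure_ge0. Qed.

Let fibre_measure_sigma_additive : semi_sigma_additive (fibre_measure r).
Proof.
move=> F mF tF mUF; rewrite /fibre_measure.
rewrite (_ : [set x : Om | (\bigcup_n F n) (x, r)] =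
  \bigcup_n [set x : Om | F n (x, r)]); last first.
  by apply/seteqP; split=> x [n _ Fn]; exists n.
apply: measure_semi_sigma_additive.
- by move=> n; exact: measurable_slice.
- apply/trivIsetP => i j _ _ ij; rewrite -subset0 => x /= Fx.
  have /seteqP[sub _] := (trivIsetP.1 tF) i j Logic.I Logic.I ij.
  exact: sub (x, r) Fx.
- by apply: bigcup_measurable => n _; exact: measurable_slice.
Qed.

HB.instance Definition _ := isMeasure.Build _ _ _ (fibre_measure r)
  fibre_measure0 fibre_measure_ge0 fibre_measure_sigma_additive.
End Fibre.

Let cG : {nonneg R} := (#|G|%:R^-1)%:nng.

Definition skew_measure : set X -> \bar R :=
  msum (fun k => mscale cG (fibre_measure (nth 0 (enum G) k))) #|G|.

HB.instance Definition _ := Measure.on skew_measure.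

Lemma skew_measureE (A : set X) :
  skew_measure A = (\sum_(r : G) (#|G|%:R^-1)%:E * beR [set x | A (x, r)])%E.
Proof.
rewrite /skew_measure /msum.
rewrite -(big_mkord predT (fun k => mscale cG (fibre_measure (nth 0%R (enum G) k)) A)).
rewrite [X in index_iota _ X]cardE.
by rewrite -(big_nth 0%R predT (fun r => mscale cG (fibre_measure r) A)) big_enum.
Qed.

Let G0 : #|G|%:R != 0 :> R.
Proof. by rewrite pnatr_eq0 -lt0n; apply/card_gt0P; exists 0. Qed.

Let skew_measureT : skew_measure setT = 1%E.
Proof.
rewrite skew_measureE (eq_bigr (fun=> (#|G|%:R^-1)%:E)); last first.
  by move=> r _; rewrite [X in (_ * X)%E]probability_setT mule1.
by rewrite sumEFin sumr_const -[X in X%:E]mulr_natl mulfV.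
Qed.

HB.instance Definition _ := Measure_isProbability.Build _ _ _ skew_measure skew_measureT.

Lemma pr_skew (A : set X) : measurable A ->
  pr skew_measure A = #|G|%:R^-1 * \sum_(r : G) pr beR [set x | A (x, r)].
Proof.
move=> mA; apply: EFin_inj; rewrite prE// [LHS]skew_measureE mulr_sumr -sumEFin.
by apply: eq_bigr => r _; rewrite EFinM prE//; exact: measurable_slice.
Qed.

(** On each level set of [psi] the fibre is only translated, which preserves its
    uniform law, so the claim reduces to the base. *)
Lemma skew_product_preserves (rho : I -> I) (psi : Om -> G) (A : set X) :
  injective rho -> (forall r, measurable [set x : Om | psi x = r]) ->
  measurable A ->
  measurable [set x : X | A ((fun i => x.1 (rho i)), x.2 + psi x.1)] ->
  skew_measure [set x : X | A ((fun i => x.1 (rho i)), x.2 + psi x.1)] =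
  skew_measure A.
Proof.
move=> rI mpsi mA mA'; rewrite -prE// -[RHS]prE// !pr_skew//; congr (_ * _)%:E.
pose S r : set Om := [set x | A ((fun i => x (rho i)), r)].
have mS r : measurable (S r).
  rewrite (_ : S r = (fun x i => x (rho i)) @^-1` [set x : Om | A (x, r)])//.
  by rewrite -[_ @^-1` _]setTI; apply: measurable_reindex => //; exact: measurable_slice.
transitivity (\sum_(r : G) \sum_(s : G) pr beR (S (r + s) `&` [set x | psi x = s])).
  apply: eq_bigr => r _; rewrite (@pr_partition _ _ _ _ _ psi) /=.
  - apply: eq_bigr => s _; congr pr.
    apply/seteqP; split=> x /= [Ax xs]; split=> //; move: Ax; by rewrite /S /= xs.
  - exact: (@measurable_slice I B b0 G _ r mA').
  - by [].
rewrite exchange_big /=.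
transitivity (\sum_(s : G) \sum_(r : G) pr beR (S r `&` [set x | psi x = s])).
  by apply: eq_bigr => s _; rewrite [RHS](reindex_inj (addIr s)).
rewrite exchange_big /=; apply: eq_bigr => r _.
rewrite -(@pr_partition _ _ _ _ _ psi)// /pr; congr fine.
by apply: (@bernoulli_reindex R I B b0 rho [set x | A (x, r)]) => //; exact: measurable_slice.
Qed.

End SkewMeasure.

(** * The skew space is standard Borel *)

(** A copy of the skew space bearing a metric; the field [R] of its distances
    has to be a parameter of the type. *)
Definition skew_space (R : realType) (I : countType) (B : finType) (b0 : B)
  (G : finZmodType) : Type := @skewprod I B b0 G.

Section Polish.
Variables (R : realType) (I : countType) (B : finType) (b0 : B) (G : finZmodType).
Local Notation M := (@skew_space R I B b0 G).

(** In the ball of radius [1 / k] are the points with the same fibre coordinate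
    and the same coordinates of code less than [k]. *)
Definition skew_ball (x : M) (e : R) (y : M) :=
  [/\ 0 < e, x.2 = y.2 & forall i, e * (pickle i).+1%:R <= 1 -> x.1 i = y.1 i].

Let skew_ball_center (x : M) (e : R) : 0 < e -> skew_ball x e x.
Proof. by []. Qed.

Let skew_ball_sym (x y : M) (e : R) : skew_ball x e y -> skew_ball y e x.
Proof. by move=> [e0 xy2 xy]; split=> // i /xy. Qed.

Let skew_ball_triangle (x y z : M) (e1 e2 : R) :
  skew_ball x e1 y -> skew_ball y e2 z -> skew_ball x (e1 + e2) z.
Proof.
move=> [e10 xy2 xy] [e20 yz2 yz]; split=> [||i ei]; first exact: addr_gt0.
  by rewrite xy2.
by rewrite xy ?yz//; apply: le_trans ei; rewrite ler_wpM2r// ?lerDl ?lerDr ltW.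
Qed.

HB.instance Definition _ := Pointed.copy M (@skewprod I B b0 G).
HB.instance Definition _ := hasNbhs.Build M (nbhs_ (entourage_ skew_ball)).
HB.instance Definition _ := @Nbhs_isPseudoMetric.Build R M
  (entourage_ skew_ball) erefl skew_ball skew_ball_center skew_ball_sym
  skew_ball_triangle erefl.

Let ep (n : nat) : R := n.+1%:R^-1.

Let ep_gt0 n : 0 < ep n.
Proof. by rewrite invr_gt0. Qed.

Let epP n i : ep n * (pickle i).+1%:R <= 1 <-> (pickle (i : I) <= n)%N.
Proof. by rewrite mulrC ler_pdivrMr// mul1r ler_nat ltnS. Qed.

Let ball_coord (x y : M) i : skew_ball x (ep (pickle (i : I))) y -> x.1 i = y.1 i.
Proof. by move=> [_ _]; apply; apply/epP. Qed.

Let first_coords (n : nat) : seq I := pmap unpickle (iota 0 n.+1).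

Let first_coordsP n i : (pickle i <= n)%N -> i \in first_coords n.
Proof.
move=> iN; rewrite mem_pmap -(pickleK i) map_f// mem_iota/=.
by rewrite add0n ltnS.
Qed.

(** The limit of a Cauchy filter is read off coordinate by coordinate, the
    [i]-th one being constant on a ball of radius [ep (pickle i)]. *)
Let skew_complete (F : set_system M) : ProperFilter F -> cauchy F -> cvg F.
Proof.
move=> FF /cauchyP cF.
have /choice[c Fc] n : exists x, F (skew_ball x (ep n)).
  by have [x Fx] := cF _ (ep_gt0 n); exists x.
apply/cvg_ex; exists ((fun i => (c (pickle i)).1 i), (c 0%N).2) => /=.
apply/(@fcvg_ballP R M) => e e0; have [x Fx] := cF _ e0.
near=> y; have [_ xy2 xy] : skew_ball x e y by near: y.
split=> //=.
  have [z [[_ -> _] [_ xz _]]] := filter_ex (filterI (Fc 0%N) Fx).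
  by rewrite -xy2 xz.
move=> i ei.
have [z [/ball_coord -> [_ _ xz]]] := filter_ex (filterI (Fc (pickle i)) Fx).
by rewrite -xy// xz.
Unshelve. all: by end_near. Qed.

HB.instance Definition _ := Uniform_isComplete.Build M skew_complete.

Let nbhs_skew_ball (x : M) (e : R) : 0 < e -> nbhs x (skew_ball x e).
Proof. by move=> e0; apply: (@nbhsx_ballx R M). Qed.

Let skew_hausdorff : hausdorff_space M.
Proof.
move=> p q pq.
have H n : exists z, skew_ball p (ep n) z /\ skew_ball q (ep n) z.
  exact: pq (nbhs_skew_ball p (ep_gt0 n)) (nbhs_skew_ball q (ep_gt0 n)).
rewrite (surjective_pairing p) (surjective_pairing q); congr pair.
  by apply/funext => i; have [z [/ball_coord -> /ball_coord ->]] := H (pickle i).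
by have [z [[_ -> _] [_ -> _]]] := H 0%N.
Qed.

Let open_sub_ball (U : set M) x : open U -> U x ->
  exists n, skew_ball x (ep n) `<=` U.
Proof.
rewrite openE => /(_ x) oU /oU /(@nbhs_ballP R M)[e /= e0 eU].
exists (Num.truncn e^-1); apply: subset_trans eU.
apply: (@le_ball R M); rewrite /ep -[leRHS]invrK lef_pV2 ?posrE ?invr_gt0//.
by rewrite ltW// truncnS_gt.
Qed.

Let ball_sub_open (U : set M) :
  (forall x, U x -> exists n, skew_ball x (ep n) `<=` U) -> open U.
Proof.
move=> bU; rewrite openE => x /bU[n nU].
by apply/(@nbhs_ballP R M); exists (ep n); [exact: ep_gt0|].
Qed.

(** Configurations equal to [b0] outside a finite set, coded by association
    lists. *)
Let finite_config (s : seq (I * B) * G) : M :=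
  (fun i => nth b0 (unzip2 s.1) (index i (unzip1 s.1)), s.2).

Let skew_dense : exists2 D : set M, countable D & dense D.
Proof.
exists (range finite_config).
  exact: (sub_countable (card_image_le _ _) (countableP _)).
move=> U [x Ux] oU; have [n nU] := open_sub_ball oU Ux.
pose s := [seq (i, x.1 i) | i <- first_coords n].
exists (finite_config (s, x.2)); split; last by exists (s, x.2).
apply: nU; split=> //= i /epP/first_coordsP iV; rewrite /s /unzip1 /unzip2 -!map_comp.
rewrite (_ : map _ _ = first_coords n); last by rewrite -[RHS]map_id; apply: eq_map.
by rewrite (nth_map i) ?index_mem//= nth_index.
Qed.

(** The centres of the balls of a fixed radius contained in [U] form a finitary
    set. *)
Let open_generated (U : set M) : open U -> <<s @skew_finitary I B G >> U.
Proof.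
move=> oU; pose W n := [set x : M | skew_ball x (ep n) `<=` U].
have -> : U = \bigcup_n W n.
  apply/seteqP; split=> x; first by move=> /(open_sub_ball oU)[n nU]; exists n.
  by move=> [n _]; apply; exact: skew_ball_center.
apply: sigma_algebra_bigcup => n; apply: sub_sigma_algebra => r.
exists (first_coords n) => x y xy /= Wx z [e0 yz2 yz].
apply: Wx; split=> // i ei; rewrite -(yz i ei) /= xy//.
by apply: first_coordsP; apply/epP.
Qed.

Let finitary_open (A : set M) : skew_finitary A -> open A.
Proof.
move=> fA; apply: ball_sub_open => -[x r] Ax; have [V dA] := fA r.
exists (\max_(i <- V) pickle i)%N => -[y r'] [_ /= <- xy].
apply: (dA x y) => // i iV; apply: xy; apply/epP.
exact: leq_bigmax_seq.
Qed.

Lemma skew_standard : standard_borel R (@skewM I B b0 G).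
Proof.
exists M; split; [exact: skew_hausdorff|exact: skew_dense|].
exists (fun x => x); split.
- by exists (fun x => x).
- apply: (@measurability _ _ (@skewM I B b0 G) (g_sigma_algebraType (@open M)) setT
    (fun x => x) (@open M)) => //.
  by move=> _ [U oU <-]; rewrite setTI; exact: open_generated.
- move=> A mA; rewrite image_id.
  apply: (sub_sigma_algebra2 _ mA) => C fC; exact: finitary_open.
Qed.

End Polish.

(** * Actions of a free group *)

Section WordAction.
Variables (d : nat) (X : Type).
Local Notation L := ('I_d * bool)%type.
Local Notation F := (free_group d).

Definition letter (a : L) : F := @FreeGroup d [:: a] isT.

Lemma letter_inv a : letter (inv_letter a) = (letter a)^-1%g.
Proof. by apply/val_inj. Qed.

Lemma fg_gensP (g : F) : fg_gens g <-> exists a, g = letter a.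
Proof.
split=> [[i [->|->]]|[[i [] ->]]].
- by exists (i, true); apply/val_inj.
- by exists (i, false); apply/val_inj.
- by exists i; left; apply/val_inj.
- by exists i; right; apply/val_inj.
Qed.

Variable T : L -> X -> X.
Hypothesis TK : forall a, cancel (T a) (T (inv_letter a)).

Definition word_act (g : F) (x : X) : X := foldr T x (fg_word g).

Lemma word_act_letter a x : word_act (letter a) x = T a x.
Proof. by []. Qed.

(** Compatibility with inverse letters makes the fold insensitive to free
    reduction. *)
Lemma word_actM g h x : word_act (g * h)%g x = word_act g (word_act h x).
Proof.
have TK' a y : T a (T (inv_letter a) y) = y by rewrite -{1}(inv_letterK a) TK.
have push_act a w y : foldr T y (push a w) = T a (foldr T y w).
  by case: w => //= b w; case: eqP => //= ->; rewrite TK'.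
rewrite /word_act /= /word_mul; elim: (fg_word g) => //= a w IHw.
by rewrite push_act IHw.
Qed.

Lemma word_actK g : cancel (word_act g) (word_act g^-1%g).
Proof. by move=> x; rewrite -word_actM mulVg. Qed.

Lemma word_actVK g : cancel (word_act g^-1%g) (word_act g).
Proof. by move=> x; rewrite -word_actM mulgV. Qed.

Lemma word_act_image g (A : set X) : word_act g @` A = word_act g^-1%g @^-1` A.
Proof.
apply/seteqP; split=> [_ [x Ax <-] /=|x Ax]; first by rewrite word_actK.
by exists (word_act g^-1%g x); rewrite ?word_actVK.
Qed.

Lemma word_act_invariant (A : set X) :
  (forall a x, A x -> A (T a x)) -> invariant_set word_act A.
Proof.
move=> TA; have AA g x : A x -> A (word_act g x).
  by move=> Ax; rewrite /word_act; elim: (fg_word g) => //= a w; apply: TA.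
move=> g; apply/seteqP; split=> [_ [x Ax <-]|x Ax]; first exact: AA.
by exists (word_act g^-1%g x); [exact: AA|rewrite word_actVK].
Qed.

End WordAction.

Lemma word_act_pmp (R : realType) (n : nat) d (X : measurableType d)
    (mu : probability X R) (T : 'I_n * bool -> X -> X) :
  standard_borel R X -> (forall a, cancel (T a) (T (inv_letter a))) ->
  (forall a, measurable_fun setT (T a)) ->
  (forall a A, measurable A -> mu (T a @^-1` A) = mu A) ->
  pmp_action mu (word_act T).
Proof.
move=> sX TK mT muT.
have mact g : measurable_fun setT (word_act T g).
  rewrite /word_act; elim: (fg_word g) => [|a w IHw]; first exact: measurable_id.
  exact: measurableT_comp (mT a) IHw.
split=> //.
- exact: word_actM.
- move=> g; split.
  + by exists (word_act T g^-1%g); [exact: word_actK|exact: word_actVK].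
  + exact: mact.
  + by move=> A mA; rewrite word_act_image// -[_ @^-1` _]setTI; exact: mact.
- move=> g A mA; rewrite /pushforward /word_act.
  elim: (fg_word g) A mA => //= a w IHw A mA.
  have mA' : measurable (T a @^-1` A) by rewrite -[X in measurable X]setTI; exact: mT.
  exact: (etrans (IHw _ mA') (muT a A mA)).
Qed.

(** The two families of bijections draw the same graph, so the identity map
    preserves distances. *)
Lemma word_act_isometric (R : realType) (n : nat) d (X : measurableType d)
    (mu : probability X R) (T T' : 'I_n * bool -> X -> X) :
  (forall a, cancel (T a) (T (inv_letter a))) ->
  (forall a, cancel (T' a) (T' (inv_letter a))) ->
  (forall a x, exists b, T' b x = T a x) -> (forall a x, exists b, T b x = T' a x) ->
  isometric_orbit_equivalent (@fg_gens n) (@fg_gens n) mu mu (word_act T) (word_act T').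
Proof.
move=> TK T'K TT' T'T; exists (fun x => x), setT; split.
- split; [by exists (fun x => x)|exact: measurable_id|].
  by move=> A mA; rewrite image_id.
- by [].
- by split; [exact: measurableT|exact: probability_setT|exact: word_act_invariant].
- by rewrite image_id; exact: word_act_invariant.
- move=> x x' _ _; rewrite /action_dist; congr (graph_dist _ x x').
  apply/funext => y; apply/funext => y'; apply/propext; split.
    move=> [_ /fg_gensP[a ->]]; rewrite word_act_letter => <-.
    have [b <-] := T'T a y; exists (letter b); last by rewrite word_act_letter.
    by apply/fg_gensP; exists b.
  move=> [_ /fg_gensP[a ->]]; rewrite word_act_letter => <-.
  have [b <-] := TT' a y; exists (letter b); last by rewrite word_act_letter.
  by apply/fg_gensP; exists b.
Qed.

(** * Random relabelling of the Cayley tree *)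

Section Relabelling.
Variable n : nat.
Local Notation d := n.+2.
Local Notation L := ('I_d * bool)%type.
Local Notation F := (free_group d).

(** The new letter of an edge together with its colour. *)
Definition label : Type := (L * bool)%type.
HB.instance Definition _ := Finite.on label.
HB.instance Definition _ := GRing.Zmodule.on label.

Definition symbol : finType := ({perm L} * {ffun 'I_d -> bool})%type.

Definition symbol0 : symbol := (1%g, [ffun=> false]).

(** The colour is a function of the axis of the new letter: thus the two edges
    at a vertex that bear a new letter and its inverse have the same colour. *)
Definition lab (b : symbol) (s : L) : label := (b.1 s, b.2 (b.1 s).1).

Definition opp_label : label := ((0, true), false).

Lemma opp_label2 : opp_label + opp_label = 0.
Proof.
by rewrite (_ : opp_label + opp_label = ((0 + 0, false), false))// addr0.
Qed.

Lemma opp_labelE (z : label) : (z + opp_label).1 = inv_letter z.1.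
Proof.
case: z => [[i e] c]; rewrite /= /inv_letter /=.
by congr pair; [exact: addr0|exact: addbT].
Qed.

Lemma opp_label_colour (z : label) : (z + opp_label).2 = z.2.
Proof. by case: z => [[i e] c]; exact: addbF. Qed.

Lemma perm2P (T : finType) (s s' u u' : T) : s != s' -> u != u' ->
  exists p : {perm T}, p s = u /\ p s' = u'.
Proof.
move=> ss' uu'; exists (tperm s u * tperm (tperm s u s') u')%g.
rewrite !permM tpermL; split; last by rewrite tpermL.
have wu : tperm s u s' != u.
  by rewrite -[X in _ != X](tpermL s u) (inj_eq perm_inj) eq_sym.
by rewrite tpermD// eq_sym.
Qed.

(** The images of [s] and [s'] are two arbitrary distinct letters.  Taking them
    on different axes leaves the two colours free; this excludes two values of
    their difference, and [z] excludes a third one, among the [2 d >= 4]. *)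
Lemma lab_spreading (s s' : L) : s != s' ->
  spreading (fun b => lab b s' - lab b s).
Proof.
move=> ss' [z1 z2].
have [x [x0 xt xz]] : exists x : L, [/\ x != 0%R, x != (0%R, true) & x != z1].
  have /card_gt0P[x] : (0 < #|[predC [:: (0%R : L); (0%R, true); z1]]|)%N.
    rewrite -(ltn_add2l #|[:: (0%R : L); (0%R, true); z1]|) cardC addn0.
    apply: leq_ltn_trans (card_size _) _.
    by rewrite card_prod card_ord card_bool /= muln2 -addnn !addSn !addnS.
  by rewrite !inE !negb_or => /and3P[]; exists x.
have x10 : x.1 != 0.
  by case: x x0 xt {xz} => i [] /= h1 h2; [move: h2|move: h1]; apply: contra => /eqP ->.
have x0' : 0%R != x by rewrite eq_sym.
have xz' : 0%R != x - z1 by rewrite eq_sym subr_eq0.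
have [p [ps ps']] := perm2P ss' x0'; have [p' [p's p's']] := perm2P ss' xz'.
pose k : {ffun 'I_d -> bool} := [ffun i => (i == x.1) && z2].
exists (p, k), (p', [ffun=> false]).
rewrite /lab /= ps ps' p's p's' !ffunE eqxx /=.
rewrite [_ == _](_ : _ = false); last by rewrite eq_sym; apply/negbTE.
rewrite (_ : (0%R, false && z2) = 0 :> label)// !subr0.
rewrite [LHS](_ : _ = (x - (x - z1), z2 - false))//; congr pair; first by rewrite subKr.
exact: addbF.
Qed.

Local Notation Om := (@configM F symbol symbol0).
Local Notation X := (@skewM F symbol symbol0 label).

Definition psi (a : L) (x : Om) : label :=
  lab (x 1%g) a + opp_label - lab (x (letter a)) (inv_letter a).

(** Moving the root along the edge [a]; the fibre coordinate is updated so that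
    the two ends of that edge give it opposite labels of the same colour
    (lemma [edge_label_step]). *)
Definition step (a : L) (x : X) : X :=
  (fun v => x.1 (v * letter a)%g, x.2 + psi a x.1).

Definition edge_label (x : X) (a : L) : label := x.2 + lab (x.1 1%g) a.

Lemma edge_label_step a x :
  edge_label (step a x) (inv_letter a) = edge_label x a + opp_label.
Proof. by rewrite /edge_label /= /psi mul1g -!addrA addNr addr0. Qed.

Lemma stepK a : cancel (step a) (step (inv_letter a)).
Proof.
move=> [x r]; rewrite /step /=; congr pair.
  by apply/funext => v; rewrite letter_inv -mulgA mulVg mulg1.
rewrite -addrA -[RHS]addr0; congr (_ + _).
rewrite /psi letter_inv mulVg mul1g inv_letterK.
by rewrite !addrA subrK -[_ + opp_label + opp_label]addrA opp_label2 addr0 subrr.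
Qed.

(** The letter at [x] whose new name is [t]. *)
Definition letter_named (x : X) (t : L) : L := ((x.1 1%g).1^-1)%g (t - x.2.1).

Lemma letter_namedP x t a : (edge_label x a).1 = t <-> letter_named x t = a.
Proof.
rewrite /letter_named; split=> [<-|<-]; last by rewrite /= permKV addrC subrK.
by rewrite /= addrAC subrr add0r permK.
Qed.

Definition renamed_step (t : L) (x : X) : X := step (letter_named x t) x.

Lemma letter_named_step x t :
  letter_named (renamed_step t x) (inv_letter t) = inv_letter (letter_named x t).
Proof.
apply/letter_namedP; rewrite /renamed_step edge_label_step opp_labelE.
by congr inv_letter; apply/letter_namedP.
Qed.

Lemma renamed_stepK t : cancel (renamed_step t) (renamed_step (inv_letter t)).
Proof. by move=> x; rewrite {1}/renamed_step letter_named_step stepK. Qed.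

Lemma renamed_step_edge a x : renamed_step (edge_label x a).1 x = step a x.
Proof. by rewrite /renamed_step (letter_namedP x _ a).1. Qed.

(** The colour of the line of axis [t] through the root. *)
Definition colour (t : L) (x : X) : bool := (edge_label x (letter_named x t)).2.

Lemma edge_colour_axis x a a' : (edge_label x a').1.1 = (edge_label x a).1.1 ->
  (edge_label x a').2 = (edge_label x a).2.
Proof. by rewrite /edge_label /= => /addrI ->. Qed.

(** The edge that was just followed and the next edge named [t] lie on the same
    axis at the new root, hence have the same colour. *)
Lemma colour_step t x : colour t (renamed_step t x) = colour t x.
Proof.
rewrite /colour -[RHS]opp_label_colour -edge_label_step -/(renamed_step t x).
apply: edge_colour_axis.
have /letter_namedP -> := erefl (letter_named (renamed_step t x) t).
rewrite edge_label_step opp_labelE; have /letter_namedP -> := erefl (letter_named x t).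
by [].
Qed.

End Relabelling.

(** * Mixing *)

Lemma drop_reduced d k (w : seq ('I_d * bool)) : reduced w -> reduced (drop k w).
Proof. by move=> rw; rewrite /reduced; exact: drop_sorted. Qed.

Section Displacement.
Variable n : nat.
Local Notation d := n.+2.
Local Notation L := ('I_d * bool)%type.
Local Notation F := (free_group d).
Local Notation B := (symbol n).
Local Notation G := (label n).
Local Notation Om := (@configM F B (symbol0 n)).
Local Notation X := (@skewM F B (symbol0 n) G).
Local Notation e := (opp_label n).

(** The suffixes of the word [h] are the vertices of the path from [1] to [h]. *)
Definition tail_vertex (h : F) (k : nat) : F :=
  FreeGroup (drop_reduced k (fg_reduced h)).

Definition letter_at (h : F) (k : nat) : L := nth (ord0, true) h k.

Lemma letterM a w (rw : reduced w) (raw : reduced (a :: w)) :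
  (letter a * @FreeGroup d w rw)%g = FreeGroup raw.
Proof.
apply/val_inj => /=; rewrite /push.
by case: w rw raw => //= b u _ /andP[/negPf ->].
Qed.

Definition displacement (h : F) (x : Om) : G :=
  \sum_(0 <= k < size h) (lab (x (tail_vertex h k.+1)) (letter_at h k) + e -
                          lab (x (tail_vertex h k)) (inv_letter (letter_at h k))).

Lemma word_act_stepE h (x : X) :
  word_act (@step n) h x = (fun v => x.1 (v * h)%g, x.2 + displacement h x.1).
Proof.
case: h => w rw; elim: w rw => [|a w IHw] rw.
  rewrite /displacement big_geq// addr0 [LHS](_ : _ = x)//; case: x => x r; congr pair.
  by apply/funext => v; rewrite (_ : FreeGroup rw = 1%g) ?mulg1//; apply/val_inj.
have rw' : reduced w := path_sorted rw.
rewrite [LHS](_ : _ = step a (word_act (@step n) (FreeGroup rw') x))// IHw.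
rewrite /step /=; congr pair; first by apply/funext => v; rewrite -mulgA letterM.
rewrite -addrA; congr (_ + _); rewrite /displacement [RHS]big_nat_recl//= addrC.
congr (_ + _).
  rewrite /psi mul1g letterM /letter_at /=.
  by congr (lab (x.1 _) _ + _ - lab (x.1 _) _); apply/val_inj; rewrite /= ?drop0.
apply: eq_bigr => k _.
by congr (lab (x.1 _) _ + _ - lab (x.1 _) _); apply/val_inj.
Qed.

(** Contribution of the interior vertex [v] of the path from [1] to [h]: it is
    left by one letter and was entered by another, and its symbol is used for
    both. *)
Definition vertex_term (h v : F) (b : B) : G :=
  lab b (letter_at h (size h - size v).-1) -
  lab b (inv_letter (letter_at h (size h - size v))).

Definition inner (h : F) : seq F := [seq tail_vertex h k.+1 | k <- iota 0 (size h).-1].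

Lemma size_tail_vertex h k : size (tail_vertex h k) = (size h - k)%N.
Proof. by rewrite /= size_drop. Qed.

Lemma inner_uniq h : uniq (inner h).
Proof.
rewrite map_inj_in_uniq ?iota_uniq// => i j.
rewrite !mem_iota add0n /= !ltn_predRL => ih jh.
move=> /(congr1 (fun g : F => size g)); rewrite !size_tail_vertex => ij.
have := congr1 (fun m => size h - m)%N ij.
by rewrite !subKn ?(ltnW ih) ?(ltnW jh)//; case.
Qed.

(** Reducedness of [h] says that the path never leaves a vertex through the edge
    by which it came. *)
Lemma vertex_term_spreading h v : v \in inner h -> spreading (vertex_term h v).
Proof.
move=> /mapP[k]; rewrite mem_iota add0n /= => kh ->; rewrite /vertex_term size_tail_vertex.
rewrite ltn_predRL in kh; rewrite subKn ?(ltnW kh)//=.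
apply: lab_spreading; have := fg_reduced h; rewrite /reduced /letter_at.
move=> /(sortedP (ord0, true))/(_ k kh); apply: contra => /eqP <-.
by rewrite inv_letterK.
Qed.

Lemma displacementE (h : F) (x : Om) : (0 < size h)%N ->
  displacement h x =
  lab (x (tail_vertex h (size h))) (letter_at h (size h).-1) +
  (e - lab (x (tail_vertex h 0)) (inv_letter (letter_at h 0))) + e *+ (size h).-1 +
  \sum_(v <- inner h) vertex_term h v (x v).
Proof.
rewrite /displacement /inner big_map; case hE: (size h) => [//|m] _ /=.
under eq_bigr do rewrite -addrA.
rewrite big_split /= [X in X + _]big_nat_recr//= [X in _ + X]big_nat_recl//=.
rewrite big_split /= sumr_const_nat subn0 -!addrA.
rewrite [LHS]addrCA; congr (_ + _).
rewrite [LHS]addrCA; congr (_ + _); rewrite [LHS]addrCA; congr (_ + _).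
rewrite [LHS]addrCA; congr (_ + _).
rewrite -big_split /= /index_iota subn0; apply: eq_big_seq => k.
by rewrite mem_iota add0n /= => /ltnW km; rewrite /vertex_term size_tail_vertex hE subKn.
Qed.

Variable R : realType.
Local Notation beR := (@bernoulli R F B (symbol0 n)).
Local Notation P := (pr beR).
Local Notation rho := (1 - #|{: B}|%:R^-1 : R).

Lemma rho_itv : 0 <= rho < 1.
Proof.
have B0 : (0 < #|{: B}|)%N by apply/card_gt0P; exists (symbol0 n).
rewrite gtrBl invr_gt0 ltr0n B0 andbT subr_ge0 invf_le1 ?ltr0n//.
by rewrite ler1n.
Qed.

(** The interior vertices of the path outside [W] are resampled; there are at
    least [size h - 1 - size W - 2] of them, the two end points of the path being
    set aside too. *)
Lemma displacement_equidistribution (h : F) W (C : set Om) r : (0 < size h)%N ->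
  determined_by W C ->
  `|P (C `&` [set x | displacement h x = r]) - #|{: G}|%:R^-1 * P C| <=
  rho ^+ ((size h).-1 - (size W).+2).
Proof.
move=> h0 dC; set W' := tail_vertex h (size h) :: tail_vertex h 0 :: W.
pose good := [seq v <- inner h | v \notin W'].
pose bad := [seq v <- inner h | v \in W'].
pose Psi (x : Om) : G := lab (x (tail_vertex h (size h))) (letter_at h (size h).-1) +
  (e - lab (x (tail_vertex h 0)) (inv_letter (letter_at h 0))) + e *+ (size h).-1 +
  \sum_(v <- bad) vertex_term h v (x v).
have dispE x : displacement h x = Psi x + \sum_(v <- good) vertex_term h v (x v).
  rewrite displacementE// /Psi -[RHS]addrA; congr (_ + _).
  by rewrite /good /bad !big_filter (bigID (mem W')).
have dPsi : depends_on W' Psi.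
  move=> x y xy; rewrite /Psi !xy ?inE ?eqxx ?orbT//; congr (_ + _).
  by apply: eq_big_seq => v; rewrite mem_filter => /andP[vW _]; rewrite xy.
have goodW v : v \in good -> v \notin W' by rewrite mem_filter => /andP[].
have fC : free_of good C.
  apply: determined_free dC _ => v /goodW; apply: contra => vW.
  by rewrite !inE vW !orbT.
have := @sum_equidistribution R F B (symbol0 n) G good (vertex_term h) W' Psi C
  _ _ dPsi goodW _ fC r.
under eq_set do rewrite -dispE.
move=> /(_ (filter_uniq _ (inner_uniq h))) H; apply: le_trans (H _ _) _.
- by move=> v; rewrite mem_filter => /andP[_]; exact: vertex_term_spreading.
- exact: measurable_determined dC.
have /andP[rho0 /ltW rho1] := rho_itv; apply: ler_wiXn2l => //.
rewrite leq_subLR -[X in (X <= _)%N](_ : size (inner h) = _); last first.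
  by rewrite size_map size_iota.
rewrite -(count_predC (mem W') (inner h)) -!size_filter leq_add2r.
apply: (@uniq_leq_size _ bad W'); first exact/filter_uniq/inner_uniq.
by move=> v; rewrite mem_filter => /andP[].
Qed.

End Displacement.

Section StepMixing.
Variables (R : realType) (n : nat).
Local Notation d := n.+2.
Local Notation L := ('I_d * bool)%type.
Local Notation F := (free_group d).
Local Notation B := (symbol n).
Local Notation G := (label n).
Local Notation Om := (@configM F B (symbol0 n)).
Local Notation X := (@skewM F B (symbol0 n) G).
Local Notation beR := (@bernoulli R F B (symbol0 n)).
Local Notation mu := (@skew_measure R F B (symbol0 n) G).
Local Notation act := (word_act (@step n)).

Lemma psi_depends (a : L) : depends_on [:: 1%g; letter a] (psi a : Om -> G).
Proof. by move=> x y xy; rewrite /psi !xy ?inE ?eqxx ?orbT. Qed.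

Lemma measurable_step (a : L) : measurable_fun setT (step a : X -> X).
Proof.
apply: measurable_to_skew => [v b|r]; first exact: measurable_skew_coord.
apply: measurable_skew_finitary => r'; exists [:: 1%g; letter a] => x y xy /=.
by rewrite (psi_depends xy).
Qed.

Lemma step_preserves (a : L) (A : set X) : measurable A -> mu (step a @^-1` A) = mu A.
Proof.
move=> mA; apply: (@skew_product_preserves R F B (symbol0 n) G
  (fun v => v * letter a)%g (psi a)) => //.
- exact: mulIg.
- move=> r; apply: (@measurable_determined F B (symbol0 n) [:: 1%g; letter a]).
  by apply: depends_on_fiber; exact: psi_depends.
- by rewrite -[X in measurable X]setTI; exact: measurable_step.
Qed.

Lemma step_pmp : pmp_action mu act.
Proof.
apply: word_act_pmp => //; [exact: skew_standard|exact: stepK|exact: measurable_step|].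
exact: step_preserves.
Qed.

Lemma skew_finitary_uniform (A : set X) : skew_finitary A ->
  exists V, forall r, determined_by V [set x | A (x, r)].
Proof.
move=> fA.
have /choice[V dA] : forall r : G, exists V, determined_by V [set x | A (x, r)].
  by move=> r; have [V dA] := fA r; exists V.
exists (flatten [seq V r | r <- enum {: G}]) => r.
apply: determined_by_sub (dA r) => v vV; apply/flatten_mapP; exists r => //.
by rewrite mem_enum.
Qed.

Lemma measurable_displacement (h : F) r : measurable [set x : Om | displacement h x = r].
Proof.
apply: (@measurable_determined F B (symbol0 n)
  [seq tail_vertex h k | k <- iota 0 (size h).+1]).
apply: depends_on_fiber => x y xy; apply: eq_big_nat => k /= kh.
rewrite !xy //; apply: map_f; rewrite mem_iota add0n /=; first exact: leqW.
by rewrite ltnS.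
Qed.

(** Decomposing along the fibre coordinate at the root and the displacement,
    each term is the joint probability of two independent base events and of a
    value of the displacement, and the latter is nearly uniform given the
    former. *)
Lemma finitary_correlation (A C : set X) VA VC (h : F) : (0 < size h)%N ->
  (forall r, determined_by VA [set x | A (x, r)]) ->
  (forall r, determined_by VC [set x | C (x, r)]) ->
  (forall v, v \in VA -> (v * h)%g \notin VC) ->
  `|pr mu (act h @^-1` A `&` C) - pr mu C * pr mu A| <=
  #|{: G}|%:R * (1 - #|{: B}|%:R^-1) ^+ ((size h).-1 - (size VA + size VC).+2).
Proof.
move=> h0 dA dC AC.
have mA : measurable A by apply: measurable_skew_finitary => r; exists VA.
have mC : measurable C by apply: measurable_skew_finitary => r; exists VC.
have mAh : measurable (act h @^-1` A `&` C).
  apply: measurableI => //; rewrite -[_ @^-1` _]setTI.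
  by have [_ mh _] := pmp_bimeasurable step_pmp h; apply: mh.
have G0 : #|{: G}|%:R != 0 :> R.
  by rewrite pnatr_eq0 -lt0n; apply/card_gt0P; exists 0.
pose Ah r : set Om := [set x | A ((fun v => x (v * h)%g), r)].
pose Cr r : set Om := [set x | C (x, r)].
have dAh r : determined_by [seq (v * h)%g | v <- VA] (Ah r).
  by move=> x y xy; apply: dA => v vV; apply: xy; apply/mapP; exists v.
have dE t r : determined_by ([seq (v * h)%g | v <- VA] ++ VC) (Ah r `&` Cr t).
  exact: determined_byI (dAh r) (dC t).
have mE t r : measurable (Ah r `&` Cr t) := measurable_determined (dE t r).
have prE t r : pr beR (Ah r `&` Cr t) = pr beR [set x | A (x, r)] * pr beR (Cr t).
  rewrite (pr_indep R (dAh r)); last first.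
  - by apply: determined_free (dC t) _ => _ /mapP[v vV ->]; exact: AC.
  - exact: measurable_determined (dC t).
  congr (_ * _); apply: pr_reindex_finitary; first exact: mulIg.
  by exists VA.
have -> : pr mu (act h @^-1` A `&` C) = #|{: G}|%:R^-1 *
    \sum_(t : G) \sum_(r : G)
      pr beR ((Ah (t + r) `&` Cr t) `&` [set x | displacement h x = r]).
  rewrite (pr_skew _ mAh); congr (_ * _); apply: eq_bigr => t _.
  rewrite (@pr_partition _ _ _ _ _ (displacement h)) /=; first last.
  - exact: measurable_displacement.
  - exact: (@measurable_slice F B (symbol0 n) G _ t mAh).
  apply: eq_bigr => r _; congr pr; apply/seteqP.
  by split=> x /=; rewrite word_act_stepE /= => -[[Ax Cx] dr]; split=> //; split=> //;
     move: Ax; rewrite /Ah /= dr.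
have -> : pr mu C * pr mu A = #|{: G}|%:R^-1 *
    \sum_(t : G) \sum_(r : G) (#|{: G}|%:R^-1 * pr beR (Ah (t + r) `&` Cr t)).
  rewrite (pr_skew _ mA) (pr_skew _ mC) -mulrA; congr (_ * _).
  rewrite mulr_suml; apply: eq_bigr => t _.
  rewrite (reindex_inj (addrI t)) mulrCA -mulr_sumr.
  by congr (_ * _); rewrite mulr_sumr; apply: eq_bigr => r _; rewrite prE mulrC.
rewrite -mulrBr -sumrB normrM ger0_norm ?invr_ge0//.
set M := _ ^+ _.
apply: le_trans (_ : #|{: G}|%:R^-1 * (\sum_(t : G) \sum_(r : G) M) <= _).
  rewrite ler_wpM2l ?invr_ge0//; apply: le_trans (ler_norm_sum _ _ _) _.
  apply: ler_sum => t _; rewrite -sumrB; apply: le_trans (ler_norm_sum _ _ _) _.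
  apply: ler_sum => r _; have := displacement_equidistribution R r h0 (dE t (t + r)).
  by rewrite size_cat size_map.
by rewrite !sumr_const -mulrnA -[X in _ * X <= _]mulr_natl natrM !mulrA mulVf// mul1r.
Qed.

End StepMixing.

Section Frechet.
Variable d : nat.
Local Notation F := (free_group d.+1).

Definition power_word k := nseq k (ord0 : 'I_d.+1, true).

Lemma power_reduced k : reduced (power_word k).
Proof. by case: k => //=; elim=> //= k ->. Qed.

Definition power_elt k : F := FreeGroup (power_reduced k).

Lemma finite_avoids_power (S : set F) : finite_set S -> exists k, ~ S (power_elt k).
Proof.
move=> /finite_seqP[s ->]; exists (\max_(g <- s) size g).+1 => /= ks.
have := @leq_bigmax_seq _ s xpredT (fun g : F => size g) _ ks isT.
by rewrite /= size_nseq ltnn.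
Qed.

Lemma free_group_infinite : infinite_set [set: F].
Proof. by move=> /finite_avoids_power[k]; apply. Qed.

Lemma finite_short m : finite_set [set g : F | (size g <= m)%N].
Proof.
pose f (w : m.-bseq ('I_d.+1 * bool)) : F := insubd (fg_one d.+1) (bseqval w).
apply: (@sub_finite_set _ _ (f @` setT)); last by apply/finite_image/finite_finset.
move=> g /= gm; exists (Bseq gm) => //; apply/val_inj; rewrite /f val_insubd /=.
by rewrite fg_reduced.
Qed.

End Frechet.

Lemma frechet_filter_finite (T : Type) (S : set T) :
  finite_set S -> frechet_filter (~` S).
Proof. by rewrite /frechet_filter /= setCK. Qed.


Section StepMixing2.
Variables (R : realType) (n : nat).
Local Notation d := n.+2.
Local Notation F := (free_group d).
Local Notation B := (symbol n).
Local Notation G := (label n).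
Local Notation X := (@skewM F B (symbol0 n) G).
Local Notation mu := (@skew_measure R F B (symbol0 n) G).
Local Notation act := (word_act (@step n)).
Local Notation rho := (1 - #|{: B}|%:R^-1 : R).

Local Notation fr := (@frechet_filter F : set_system F).

Let FF : ProperFilter fr := frechet_properfilter (@free_group_infinite n.+1).
Existing Instance FF.

(** The bad elements are the short ones and those translating a coordinate of
    [A] onto a coordinate of [C]: finitely many. *)
Lemma finitary_mixing (A C : set X) : skew_finitary A -> skew_finitary C ->
  pr mu (act h^-1%g @^-1` A `&` C) @[h --> fr] --> pr mu C * pr mu A.
Proof.
move=> /skew_finitary_uniform[VA dA] /skew_finitary_uniform[VC dC].
apply/cvgrPdist_lt => eps eps0.
have /cvgrPdist_lt : #|{: G}|%:R * rho ^+ m @[m --> \oo] --> (#|{: G}|%:R * 0 : R).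
  have /andP[r0 r1] := rho_itv n R.
  by apply: cvgMr; apply: cvg_expr; rewrite ger0_norm.
move=> /(_ eps eps0)[m _ /(_ m (leqnn m))] /=; rewrite mulr0 sub0r normrN => hm.
pose K := (m + (size VA + size VC).+2).+1.
have short_fin : finite_set [set h : F | (size h <= K)%N] := finite_short n.+1 K.
have coll_fin : finite_set [set ((w^-1 * v)%g : F) | w in [set` VC] & v in [set` VA]].
  by apply: finite_image2; apply: finite_seq.
have := frechet_filter_finite short_fin.
have := frechet_filter_finite coll_fin.
apply: filterS2 => h nc ns; rewrite distrC.
have hK : (K < size h^-1%g)%N.
  by rewrite /= size_rev size_map ltnNge; apply/negP.
have h0 : (0 < size h^-1%g)%N by apply: leq_ltn_trans hK.
apply: le_lt_trans (@finitary_correlation R n A C VA VC h^-1%g h0 dA dC _) _.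
  move=> v vA; apply/negP => vC; apply: nc => /=.
  by exists (v * h^-1)%g => //; exists v => //; rewrite invMg invgK -mulgA mulVg mulg1.
apply: le_lt_trans hm; rewrite ger0_norm.
  have /andP[r0 /ltW r1] := rho_itv n R.
  by rewrite ler_wpM2l//; apply: ler_wiXn2l => //; rewrite leq_subRL; lia.
by have /andP[r0 _] := rho_itv n R; rewrite mulr_ge0// exprn_ge0.
Qed.

Let mact (h : F) : measurable_fun setT (act h : X -> X).
Proof. by have [] := pmp_bimeasurable (step_pmp R n) h. Qed.

Let pr_norm (A : set X) : measurable A -> `|pr mu A| <= 1.
Proof.
by move=> mA; rewrite ger0_norm ?pr_ge0// -(pr_setT mu) pr_le.
Qed.

(** The two events are extended from finitary to measurable sets in turn. *)
Lemma step_mixing_pr (A C : set X) : measurable A -> measurable C ->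
  pr mu (act h^-1%g @^-1` A `&` C) @[h --> fr] --> pr mu C * pr mu A.
Proof.
move=> mA mC.
have mpre (h : F) : measurable (act h^-1%g @^-1` A).
  by rewrite -[_ @^-1` _]setTI; exact: mact.
under eq_fun do rewrite setIC.
rewrite mulrC.
apply: (@cvg_from_generators R _ X mu F fr (fun _ x => x)
  (fun h => act h^-1%g @^-1` A) (pr mu A) (@skew_finitary F B G)) => //.
- exact: pr_norm.
- exact: skew_finitaryT.
- exact: skew_finitaryI.
move=> {mC}C fC; rewrite mulrC; have mC := measurable_skew_finitary fC.
under eq_fun do rewrite setIC.
apply: (@cvg_from_generators R _ X mu F fr (fun h => act h^-1%g)
  (fun _ => C) (pr mu C) (@skew_finitary F B G)) => //.
- by move=> h D mD; exact: (pmp_preserving (step_pmp R n)).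
- exact: pr_norm.
- exact: skew_finitaryT.
- exact: skew_finitaryI.
- by move=> D fD; exact: finitary_mixing.
Qed.

Lemma step_mixing : mixing mu act.
Proof.
move=> A C mA mC; rewrite -!(prE mu)// -EFinM mulrC.
have mAC (h : F) : measurable ((act h @` A) `&` C).
  by apply: measurableI => //; have [_ _] := pmp_bimeasurable (step_pmp R n) h; apply.
apply: cvg_EFin.
  by apply: nearW => h; apply: fin_num_measure.
rewrite (_ : fine \o _ = fun h => pr mu (act h^-1%g @^-1` A `&` C)).
  exact: step_mixing_pr.
by apply/funext => h; rewrite /= word_act_image//; exact: stepK.
Qed.

End StepMixing2.

(** An invariant set is asymptotically independent of itself. *)
Lemma mixing_ergodic (R : realType) d d' (X : measurableType d') (mu : probability X R)
    (alpha : free_group d.+1 -> X -> X) : mixing mu alpha -> ergodic mu alpha.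
Proof.
move=> mix A mA iA; have := mix A A mA mA.
under eq_fun do rewrite iA setIid.
have FF := frechet_properfilter (@free_group_infinite d).
move=> /cvg_unique => /(_ _ _ (cvg_cst _)) => AA.
have /eqP : pr mu A * pr mu A = pr mu A.
  by apply: EFin_inj; rewrite EFinM prE// AA//; exact: ereal_hausdorff.
rewrite -subr_eq0 -[X in _ - X]mulr1 -mulrBr mulf_eq0.
by rewrite subr_eq0 => /orP[/eqP|/eqP] p; [left|right]; rewrite -prE// p.
Qed.

(** * The renamed action *)

Section Renamed.
Variables (R : realType) (n : nat).
Local Notation d := n.+2.
Local Notation L := ('I_d * bool)%type.
Local Notation F := (free_group d).
Local Notation B := (symbol n).
Local Notation G := (label n).
Local Notation X := (@skewM F B (symbol0 n) G).
Local Notation mu := (@skew_measure R F B (symbol0 n) G).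
Local Notation alpha := (word_act (@renamed_step n)).
Local Notation beta := (word_act (@step n)).

Lemma measurable_letter_named t a : measurable [set x : X | letter_named x t = a].
Proof.
apply: measurable_skew_finitary => r; exists [:: 1%g] => x y xy /=.
by rewrite /letter_named /= xy ?inE.
Qed.

Lemma measurable_colour t b : measurable [set x : X | colour t x = b].
Proof.
apply: measurable_skew_finitary => r; exists [:: 1%g] => x y xy /=.
by rewrite /colour /edge_label /letter_named /= xy ?inE.
Qed.

Lemma measurable_renamed_step t : measurable_fun setT (renamed_step t : X -> X).
Proof.
move=> _ A mA; rewrite setTI (_ : _ @^-1` A = \bigcup_(a in [set: L])
    ([set x : X | letter_named x t = a] `&` step a @^-1` A)).
  apply: fin_bigcup_measurable => [|a _]; first exact: finite_finset.
  apply: measurableI; first exact: measurable_letter_named.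
  by rewrite -[X in measurable X]setTI; exact: measurable_step.
apply/seteqP; split=> x /=; first by exists (letter_named x t).
by move=> [a _ [<-]].
Qed.

(** On the set where the letter named [t] is [a], the renamed step is [step a],
    and [step a] maps this set onto the one where the letter named [t^-1] is
    [a^-1]. *)
Lemma renamed_step_preserves t (A : set X) : measurable A ->
  mu (renamed_step t @^-1` A) = mu A.
Proof.
move=> mA; have mA' : measurable (renamed_step t @^-1` A).
  by rewrite -[X in measurable X]setTI; exact: measurable_renamed_step.
rewrite -prE// -[RHS]prE//; congr EFin.
rewrite (@pr_partition _ _ _ _ _ (fun x : X => letter_named x t) _ mA'); last first.
  exact: measurable_letter_named.
rewrite [RHS](@pr_partition _ _ _ _ _ (fun x : X => letter_named x (inv_letter t)) _ mA);
  last exact: measurable_letter_named.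
rewrite [RHS](reindex_inj (inv_inj (@inv_letterK d))); apply: eq_bigr => a _.
transitivity (pr mu (step a @^-1`
    (A `&` [set x : X | letter_named x (inv_letter t) = inv_letter a]))); last first.
  congr fine; apply: step_preserves; apply: measurableI => //.
  exact: measurable_letter_named.
congr (pr mu _); apply/seteqP; split=> x /= [].
  by move=> Ax <-; split=> //; exact: letter_named_step.
move=> Ax; have := letter_named_step (step a x) (inv_letter t).
rewrite /renamed_step inv_letterK => + xa; rewrite xa stepK inv_letterK => xt.
by split=> //; rewrite /renamed_step xt.
Qed.

Lemma renamed_pmp : pmp_action mu alpha.
Proof.
apply: word_act_pmp => //.
- exact: skew_standard.
- exact: renamed_stepK.
- exact: measurable_renamed_step.
- exact: renamed_step_preserves.
Qed.

Lemma renamed_isometric :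
  isometric_orbit_equivalent (@fg_gens d) (@fg_gens d) mu mu alpha beta.
Proof.
apply: word_act_isometric; [exact: renamed_stepK|exact: stepK|..] => a x.
  by exists (letter_named x a).
by exists (edge_label x a).1; exact: renamed_step_edge.
Qed.

(** The two actions have the same orbits, hence the same invariant sets. *)
Lemma renamed_ergodic : ergodic mu alpha.
Proof.
move=> A mA iA; have ergo := mixing_ergodic (@step_mixing R n); apply: (ergo A mA).
apply: word_act_invariant; first exact: stepK.
move=> a x Ax; rewrite -renamed_step_edge -(iA (letter (edge_label x a).1)).
by exists x.
Qed.

(** Translating the fibre by the non-trivial colour preserves the measure and
    exchanges the two colours. *)
Lemma pr_colour t : pr mu [set x : X | colour t x = true] = 2^-1.
Proof.
pose c : G := ((0%R, false), true).
have colourE (x : X) : colour t (x.1, x.2 + c) = ~~ colour t x.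
  rewrite /colour (_ : letter_named (x.1, x.2 + c) t = letter_named x t); last first.
    by rewrite /letter_named /= [X in t - X](_ : _ = x.2.1 + 0)// addr0.
  have add2 (u v : G) : (u + v).2 = u.2 (+) v.2 by [].
  by rewrite /edge_label !add2 /= addbAC addbT.
have flip : pr mu [set x : X | colour t x = true] =
    pr mu [set x : X | colour t x = false].
  have E : [set x : X | colour t x = false] =
      [set x : X | [set x | colour t x = true]
        ((fun v => x.1 (id v)), x.2 + (fun=> c) x.1)].
    apply/seteqP; split=> x /=; rewrite (_ : (fun v => x.1 v) = x.1)// colourE.
      by move=> ->.
    by case: colour.
  rewrite E /pr; congr fine; symmetry.
  apply: (@skew_product_preserves R F B (symbol0 n) G id (fun=> c)) => //.
  - move=> r; have [->|rc] := pselect (r = c).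
      by rewrite (_ : [set _ | _] = setT)// -subTset.
    by rewrite (_ : [set _ | _] = set0)// -subset0 => x /= /esym.
  - exact: measurable_colour.
  - by rewrite -E; exact: measurable_colour.
have := prC mu (measurable_colour t true).
rewrite (_ : ~` _ = [set x : X | colour t x = false]); last first.
  by apply/seteqP; split=> x /=; case: colour.
by rewrite -flip; move: (pr mu _) => p pE; clear -pE; lra.
Qed.

(** Powers of one generator preserve the colour of its line through the root,
    which is therefore not asymptotically independent of itself. *)
Lemma renamed_not_mixing : ~ mixing mu alpha.
Proof.
pose t : L := (ord0, true); pose S : set X := [set x | colour t x = true].
have mS : measurable S := measurable_colour t true.
have aS k : alpha (power_elt n.+1 k) @` S = S.
  have col x : colour t (alpha (power_elt n.+1 k) x) = colour t x.
    by rewrite /word_act /=; elim: k => //= k IHk; rewrite colour_step.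
  apply/seteqP; split=> [_ [x Sx <-]|x Sx]; first by rewrite /S /= col.
  exists (alpha (power_elt n.+1 k)^-1%g x); last first.
    by rewrite word_actVK//; exact: renamed_stepK.
  by rewrite /S /= -col word_actVK//; exact: renamed_stepK.
have FF := frechet_properfilter (@free_group_infinite n.+1).
move=> /(_ S S mS mS); rewrite -(prE mu mS) pr_colour -EFinM => /fine_cvgP[_].
have e0 : 0 < 8^-1 :> R by rewrite invr_gt0.
move=> /cvgrPdist_lt/(_ _ e0) fin; have [k] := finite_avoids_power fin.
apply=> /=; rewrite aS setIid -/(pr mu S) pr_colour ltr_norml => /andP[h _].
by lra.
Qed.

End Renamed.

Theorem theorem1p4 (R : realType) (d : nat) (hd : (2 <= d)%N) :
  exists (dX dY : measure_display)
         (X : measurableType dX) (Y : measurableType dY)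
         (mu : probability X R) (nu : probability Y R)
         (alpha : free_group d -> X -> X) (beta : free_group d -> Y -> Y),
    [/\ pmp_action mu alpha /\ ergodic mu alpha,
        pmp_action nu beta /\ ergodic nu beta,
        isometric_orbit_equivalent (@fg_gens d) (@fg_gens d) mu nu alpha beta,
        ~ mixing mu alpha &
        mixing nu beta].
Proof.
case: d hd => [|[|n]] // _.
pose X := @skewM (free_group n.+2) (symbol n) (symbol0 n) (label n).
pose mu : probability X R :=
  @skew_measure R (free_group n.+2) (symbol n) (symbol0 n) (label n).
eexists; eexists; exists X, X, mu, mu.
exists (word_act (@renamed_step n)), (word_act (@step n)); split.
- by split; [exact: renamed_pmp|exact: renamed_ergodic].
- by split; [exact: step_pmp|exact/mixing_ergodic/step_mixing].
- exact: renamed_isometric.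
- exact: renamed_not_mixing.
- exact: step_mixing.
Qed.
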